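(* The following statements are equivalent: (1) the Four Colour Theorem is true; (2) for every connected, loopless plane graph $G$, $(-1)^{v(G)}R(G^{\times};-2,-3,1/3)<0$; (3) for every connected, loopless plane graph $G$, $(-1)^{v(G)}R(G^{\times};-3,-4,1/4)<0$; (4) for every connected, loopless plane graph $G$, $R(G^{\times};3,2,-1/2)\neq 0$.
   Context: The Four Colour Theorem is the statement that every loopless plane graph has a proper vertex colouring with at most four colours. An embedded graph is a graph (loops and multiple edges allowed) cellularly embedded in a closed, possibly non-orientable, surface, i.e. each face is an open disc. Equivalently, it is a ribbon graph: a surface with boundary written as a union of vertex discs and edge discs (ribbons), each edge disc meeting the vertex discs in exactly two disjoint arcs. A plane graph is a connected embedded graph of Euler genus $0$ (embedded in the sphere). $v(G)=|V(G)|$, $c(G)$ is the number of connected components, $r(G)=v(G)-c(G)$, $n(G)=|E(G)|-r(G)$, and $f(G)$ is the number of boundary components of the ribbon graph. For $A\subseteq E(G)$, $c(A),r(A),n(A),f(A)$ refer to the spanning ribbon subgraph $(V(G),A)$. The Petrie dual $G^{\times}$ is the ribbon graph obtained from $G$ by adding a half-twist to every edge. Ribbon graph (Bollobás–Riordan) polynomial: $R(G;x,y,z)=\sum_{A\subseteq E(G)}(x-1)^{r(G)-r(A)}y^{n(A)}z^{c(A)-f(A)+n(A)}$. *)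

(* Defs.v *)
From HB Require Import structures.
From mathcomp Require Import all_boot all_order all_fingroup all_algebra.

Set Implicit Arguments.
Unset Strict Implicit.
Unset Printing Implicit Defensive.

Import GRing.Theory.
Local Open Scope ring_scope.

(* A ribbon graph, given by a signed rotation system.  Each edge e has the two
   ends (e, false) and (e, true), its half-edges; naming them does not orient e.
   Each vertex disc carries a local orientation, for which [rot] sends a
   half-edge to the next one around its vertex; [twisted e] tells whether the
   ribbon e is half-twisted with respect to the local orientations at its ends.
   The half-edges at a vertex form one cycle of [rot]; a vertex that is not in
   the image of [att] is isolated. *)
Record ribbon_graph := RibbonGraph {
  vertex : finType;
  edge : finType;
  att : edge * bool -> vertex;
  rot : {perm (edge * bool)%type};
  twisted : edge -> bool;
  att_rot : forall h k, (att h == att k) = (k \in porbit rot h) }.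

Definition opp_half (T : Type) (h : T * bool) : T * bool := (h.1, ~~ h.2).

Definition petrie_dual (G : ribbon_graph) : ribbon_graph :=
  RibbonGraph (fun e => ~~ twisted e) (@att_rot G).

Section Invariants.

Variable G : ribbon_graph.
Implicit Types A : {set edge G}.

Definition adj A : rel (vertex G) := fun u v =>
  [exists h : edge G * bool,
    [&& h.1 \in A, att h == u & att (opp_half h) == v]].

Lemma adj_sym A : symmetric (adj A).
Proof.
suff sub u v : adj A u v -> adj A v u by move=> u v; apply/idP/idP; apply: sub.
case/existsP=> -[e b] /and3P[/= eA hu hv]; apply/existsP.
by exists (e, ~~ b); rewrite /opp_half /= negbK eA hu hv.
Qed.

Definition num_comp A : nat := n_comp (adj A) predT.

(* A half-edge h covers an arc of the boundary of its vertex disc; (h, false)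
   and (h, true) are the first and the last point of this arc in the direction
   of [rot].  The boundary of the ribbon subgraph (V(G), A) is cut by these
   points into the arcs of vertex discs between consecutive half-edges
   ([corner_arc]), the sides of the ribbons in A, and, for each half-edge not in
   A, the arc it covers, which is then not glued to any ribbon ([end_arc]). *)
Definition flag : finType := ((edge G * bool) * bool)%type.

Definition corner_arc : rel flag := fun p q =>
  [&& p.2, ~~ q.2 & q.1 == rot G p.1].

Definition end_arc A (p : flag) : flag :=
  let: (h, s) := p in
  if h.1 \in A then (opp_half h, if twisted h.1 then s else ~~ s)
  else (h, ~~ s).

Definition boundary_adj A : rel flag := fun p q =>
  [|| corner_arc p q, corner_arc q p | q == end_arc A p].

Lemma end_arcK A : involutive (end_arc A).
Proof.
case=> -[e b] s; rewrite /end_arc /opp_half /=.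
by case eA: (e \in A); rewrite /= eA ?negbK //; case: (twisted e); rewrite ?negbK.
Qed.

Lemma boundary_adj_sym A : symmetric (boundary_adj A).
Proof.
move=> p q; rewrite /boundary_adj orbCA; congr [|| _, _ | _].
by apply/eqP/eqP => ->; rewrite end_arcK.
Qed.

(* Only vertices isolated in G are added: the boundary of any other vertex disc
   contains flags, even if no edge in A meets that vertex. *)
Definition num_bdry A : nat :=
  (n_comp (boundary_adj A) predT
   + #|[set v : vertex G | [forall h, att h != v]]|)%N.

(* Integer-valued, so that no subtraction below is truncated. *)
Definition rank A : int := #|vertex G|%:Z - (num_comp A)%:Z.

Definition nullity A : int := #|A|%:Z - rank A.

Definition euler_genus : int :=
  (num_comp setT)%:Z *+ 2
  - (#|vertex G|%:Z - #|edge G|%:Z + (num_bdry setT)%:Z).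

Definition connected : Prop := num_comp setT = 1%N.

Definition loopless : Prop :=
  forall e : edge G, att (e, false) != att (e, true).

Definition plane : Prop := connected /\ euler_genus = 0.

Definition proper_colouring (C : Type) (col : vertex G -> C) : Prop :=
  forall e : edge G, col (att (e, false)) <> col (att (e, true)).

(* The value of the ribbon graph polynomial at (x, y, z); all the exponents are
   nonnegative. *)
Definition ribbon_poly (F : fieldType) (x y z : F) : F :=
  \sum_(A : {set edge G})
    (x - 1) ^ (rank setT - rank A) * y ^ nullity A
    * z ^ ((num_comp A)%:Z - (num_bdry A)%:Z + nullity A).

End Invariants.

Definition four_colour_theorem : Prop :=
  forall G : ribbon_graph, plane G -> loopless G ->
    exists col : vertex G -> 'I_4, proper_colouring col.

(* Main.v *)
(* With y = x - 1 = -l and z = 1/l all powers collect, and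
   (-1)^v(G) R(G^x; 1 - l, -l, 1/l) = -P(l)/l, where P(l) is the sum over A of
   (-1)^|A| l^f(A), f(A) counting the boundary components of the spanning
   subgraph A of the Petrie dual.  The three evaluations are l = 3, 4, -2.

   For a positive integer l, l^f(A) counts the l-valued labellings of the
   corners of G that are constant along these components, so P(l) counts
   labellings with sign (-1)^(number of crossings), where at each edge exactly
   one of "not crossing" and "crossing" holds.  Label with F_2^2 (l = 4) or its
   nonzero elements (l = 3).  As the first homology of the sphere vanishes, a
   labelling is a sum a(vertex) + b(face), and then a is a proper colouring and
   the number of crossings is even.  So P(4) > 0 iff G is 4-colourable, and
   P(3) > 0 implies P(4) > 0.  Conversely a 4-colouring of the plane graph
   obtained by joining a new vertex in each face to all corners of that face
   gives a labelling without the value 0, so the Four Colour Theorem for that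
   graph gives P(3) > 0.

   For l = -2, the binor identity (-2)^f1 + (-2)^f2 + (-2)^f3 = 0 holds for the
   three ways of reconnecting the boundary at an edge.  It turns P(-2) into a
   sum over the untwisted spanning subgraphs, where Euler's formula applies;
   this gives (-2)^v P(-2) = 2^|E| * (number of 4-colourings of G). *)
Require Import Defs.
From mathcomp Require Import all_boot all_order all_fingroup all_algebra.
From mathcomp Require Import mxabelem zify ring lra.

Set Implicit Arguments.
Unset Strict Implicit.
Unset Printing Implicit Defensive.

Import GRing.Theory Num.Theory.

(** * Components of a relation *)

Section Components.

Variable T : finType.
Implicit Types (r : rel T) (x y : T).

Definition add_edge r x y : rel T := fun u v =>
  [|| r u v, (u == x) && (v == y) | (u == y) && (v == x)].

Lemma add_edge_sym r x y : symmetric r -> symmetric (add_edge r x y).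
Proof.
move=> sr u v; rewrite /add_edge (sr u v); congr orb.
by rewrite orbC andbC; congr orb; rewrite andbC.
Qed.

Definition invariant_fun (S : Type) r (g : T -> S) :=
  forall x y, r x y -> g x = g y.

Lemma connect_invariant (S : Type) r (g : T -> S) x y :
  invariant_fun r g -> connect r x y -> g x = g y.
Proof.
move=> gP /connectP[p]; elim: p x => [|z p IHp] x /= => [_ -> //|].
by case/andP=> /gP-> /IHp.
Qed.

Lemma n_comp_card_ge r (S : finType) (g : T -> S) : symmetric r ->
  invariant_fun r g -> #|codom g| <= n_comp r predT.
Proof.
move=> sr gP; have sc := sym_connect_sym sr.
apply: (@leq_trans #|[set g x | x in predI (roots r) predT]|); last first.
  exact: leq_imset_card.
apply/subset_leq_card/subsetP=> _ /codomP[x ->].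
rewrite (connect_invariant gP (connect_root r x)); apply: imset_f.
by apply/andP; split; rewrite //; apply: roots_root.
Qed.

Lemma n_comp_card_le r (S : finType) (g : T -> S) : symmetric r ->
  (forall x y, g x = g y -> connect r x y) -> n_comp r predT <= #|codom g|.
Proof.
move=> sr gP; have sc := sym_connect_sym sr.
rewrite /n_comp_mem -(@card_in_imset _ _ g (predI (roots r) predT)).
  by apply/subset_leq_card/subsetP=> _ /imsetP[x _ ->]; apply: codom_f.
move=> x y /andP[/eqP rx _] /andP[/eqP ry _] /gP; rewrite -rx -ry.
by move/(fingraph.rootP sc); rewrite !root_root.
Qed.

Lemma n_comp_add_edge r x y : symmetric r ->
  n_comp (add_edge r x y) predT + ~~ connect r x y = n_comp r predT.
Proof.
move=> sr; have sc := sym_connect_sym sr.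
have sr' := add_edge_sym x y sr; have sc' := sym_connect_sym sr'.
set r' := add_edge r x y in sr' sc' *.
have sub : subrel (connect r) (connect r').
  by apply: connect_sub => u v uv; apply: connect1; rewrite /r' /add_edge uv.
have xy' : connect r' x y by apply: connect1; rewrite /r' /add_edge !eqxx orbT.
case: (boolP (connect r x y)) => [xy | nxy].
  rewrite addn0; apply: eq_n_comp => u v; apply/idP/idP; last exact: sub.
  apply: connect_sub => {}u {}v /or3P[/connect1 // | /andP[/eqP-> /eqP->] //|].
  by rewrite sc; case/andP=> /eqP-> /eqP->.
(* [g] moves the component of [y] to the root of [x]; it classifies the new components, and of the
   old roots it misses exactly that of [y]. *)
pose g u := if connect r y u then fingraph.root r x else fingraph.root r u.
have gr' u : connect r' u (g u).
  rewrite /g; case: ifP => [/sub yu|_]; last exact/sub/connect_root.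
  apply: connect_trans (sub _ _ (connect_root r x)).
  by rewrite sc' (connect_trans xy').
have gx : g x = fingraph.root r x by rewrite /g; case: ifP.
have gy : g y = fingraph.root r x by rewrite /g connect0.
have -> : n_comp r' predT = #|codom g|.
  apply/eqP; rewrite eqn_leq n_comp_card_le ?n_comp_card_ge //.
    move=> u v /or3P[uv|/andP[/eqP-> /eqP->]|/andP[/eqP-> /eqP->]].
    - rewrite /g -(same_connect_r sc (connect1 uv)); case: ifP => // _.
      exact/(fingraph.rootP sc)/connect1.
    - by rewrite gx gy.
    - by rewrite gx gy.
  by move=> u v guv; apply: connect_trans (gr' u) _; rewrite guv sc'.
rewrite [RHS](cardD1 (fingraph.root r y)).
have -> : fingraph.root r y \in predI (roots r) predT by apply/andP; rewrite roots_root.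
rewrite addnC; congr (1 + _); apply: eq_card => z.
rewrite !inE /= andbT; apply/idP/andP => [/codomP[u ->] | [zy /eqP rz]].
  rewrite /g; case: ifP => [_|/negbT nyu]; split; try exact: roots_root.
    by rewrite root_connect.
  by rewrite root_connect // sc.
apply/codomP; exists z; rewrite /g -(root_connect sc) rz eq_sym.
by rewrite (negPf zy).
Qed.

Definition inv_funs (S : finType) (C : {set S}) r :=
  [set g : {ffun T -> S} | [forall x, g x \in C]
                         && [forall x, forall y, r x y ==> (g x == g y)]].

Lemma inv_funsP (S : finType) (C : {set S}) r (g : {ffun T -> S}) :
  reflect ((forall x, g x \in C) /\ invariant_fun r g) (g \in inv_funs C r).
Proof.
rewrite inE; apply: (iffP andP) => -[/forallP gC gr]; split=> //.
  by move=> x y xy; move/forallP/(_ x)/forallP/(_ y)/implyP: gr => /(_ xy)/eqP.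
apply/forallP=> x; apply/forallP=> y; apply/implyP=> xy; exact/eqP/gr.
Qed.

(** An invariant function is determined by its values at the roots, one per component. This turns
    powers of [#|C|] into counts of labellings. *)
Lemma card_inv_funs (S : finType) (C : {set S}) r : symmetric r ->
  #|inv_funs C r| = #|C| ^ n_comp r predT.
Proof.
move=> sr; have sc := sym_connect_sym sr.
pose R := {x | x \in roots r}.
have cardR : #|{: R}| = n_comp r predT.
  by rewrite card_sig; apply: eq_card => x; rewrite !inE andbT.
have RP x : fingraph.root r x \in roots r by apply: roots_root.
pose ext (h : {ffun R -> S}) := [ffun x => h (Sub (fingraph.root r x) (RP x))].
have ext_inj : injective ext.
  move=> h1 h2 /ffunP eq12; apply/ffunP=> -[x xr]; have := eq12 x.
  by rewrite !ffunE; congr (h1 _ = h2 _); apply: val_inj; apply/eqP: xr.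
rewrite -cardR -card_ffun_on -(card_imset _ ext_inj); apply: eq_card => g.
apply/inv_funsP/imsetP => [[gC gr] | [h /ffun_onP hC ->]].
  exists [ffun x : R => g (val x)].
    by apply/ffun_onP=> x; rewrite ffunE.
  apply/ffunP=> x; rewrite !ffunE /=.
  exact: (connect_invariant gr (connect_root r x)).
split=> [x | x y xy]; rewrite !ffunE //; congr (h _); apply: val_inj => /=.
exact/(fingraph.rootP sc)/connect1.
Qed.

Lemma n_comp_eq1 r (x : T) : symmetric r ->
  (forall g : T -> bool, invariant_fun r g -> forall y, g y = g x) ->
  n_comp r predT = 1.
Proof.
move=> sr cst; have sc := sym_connect_sym sr.
rewrite -(n_comp_connect sc x); apply: eq_n_comp_r => y.
have inv : invariant_fun r (connect r x).
  by move=> u v uv; apply: (same_connect_r sc); apply: connect1.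
by rewrite [in RHS]inE [RHS](cst _ inv) connect0.
Qed.

Lemma n_comp1_connect r (x y : T) : symmetric r -> n_comp r predT = 1 ->
  connect r x y.
Proof.
move=> sr r1; have sc := sym_connect_sym sr.
have /card_le1_eqP rP: #|predI (roots r) predT| <= 1 by rewrite -r1.
by apply/(fingraph.rootP sc)/rP; apply/andP; split=> //; apply: roots_root.
Qed.

End Components.

(** * Orbits of two involutions *)

Section Dihedral.

Variables (T : finType) (k i : T -> T).
Hypotheses (kK : involutive k) (iK : involutive i).
Implicit Types x y p q : T.

(* Its components are the orbits of the dihedral group generated by [k], [i]. *)
Definition dih : rel T := fun x y => (y == k x) || (y == i x).

Lemma dih_sym : symmetric dih.
Proof.
have eqK (f : T -> T) : involutive f -> forall x y, (y == f x) = (x == f y).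
  by move=> fK x y; rewrite -(inj_eq (can_inj fK)) fK eq_sym.
by move=> x y; rewrite /dih (eqK k) // (eqK i).
Qed.

Lemma dih_invariantP (S : Type) (g : T -> S) :
  invariant_fun dih g <-> (forall x, g (k x) = g x) /\ (forall x, g (i x) = g x).
Proof.
split=> [gP | [gk gi] x y /orP[]/eqP-> //].
by split=> x; apply/esym/gP; rewrite /dih eqxx ?orbT.
Qed.

Let f x := k (i x).
Let f_inj : injective f. Proof. by move=> x y /(inv_inj kK)/(inv_inj iK). Qed.

(** Both involutions conjugate [f] to its inverse. *)
Let iter_i n x : iter n f (i (iter n f x)) = i x.
Proof. by elim: n x => // n IHn x; rewrite iterSr iterS /f iK kK IHn. Qed.

Let iter_k n x : iter n f (k (iter n f x)) = k x.
Proof. by elim: n x => // n IHn x; rewrite iterSr iterS /f kK iK IHn. Qed.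

Let iter_inj n : injective (iter n f).
Proof. by elim: n => // n IHn x y /= /f_inj/IHn. Qed.

(** The [f]-orbit of a fixed point of [i] is closed under [i], hence is the whole component. *)
Let connect_orbit p q : i p = p -> connect dih p q ->
  exists2 n, n < fingraph.order f p & q = iter n f p.
Proof.
move=> ip pq; suff fpq : fconnect f p q.
  by exists (findex f p q); rewrite ?findex_max ?iter_findex.
have cl : invariant_fun dih (fconnect f p).
  have fi x : fconnect f p (i x) = fconnect f p x.
    suff sub y : fconnect f p y -> fconnect f p (i y).
      by apply/idP/idP=> /sub; rewrite ?iK.
    move=> /iter_findex; set n := findex _ _ _ => <-.
    rewrite fconnect_sym // -[X in fconnect f _ X]ip -(iter_i n p).
    exact: fconnect_iter.
  apply/dih_invariantP; split=> // x.
  by rewrite -{1}[x]iK -[k _]/(f _) -same_fconnect1_r.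
by rewrite -(connect_invariant cl pq) connect0.
Qed.

(* A component with a fixed point of [i] is a single cycle of [k \o i], on
   which [i] acts as a reflection; so it has exactly two fixed points. *)
Lemma dih_fixed_uniq p q q' : i p = p -> connect dih p q -> connect dih p q' ->
  i q = q -> i q' = q' -> q != p -> q' != p -> q = q'.
Proof.
move=> ip pq pq'.
(* Another fixed point [f^n p] satisfies [f^(2n) p = p] with [0 < n < order], so [2n] is the order:
   it is antipodal to [p]. *)
have half z : connect dih p z -> i z = z -> z != p ->
    exists2 n, n.*2 = fingraph.order f p & z = iter n f p.
  move=> /(connect_orbit ip)[n ltn ->] iz nz; exists n => //.
  have fix2 : iter n.*2 f p = p.
    by rewrite -addnn iterD -iz iter_i.
  have n0 : 0 < n by case: (n) nz => //=; rewrite eqxx.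
  apply/eqP; rewrite eqn_leq; apply/andP; split; last first.
    rewrite leqNgt; apply/negP=> /(findex_iter (f := f)); rewrite fix2 findex0.
    by move=> n20; move: n0; rewrite -double_gt0 -n20.
  rewrite leqNgt; apply/negP=> lt.
  have : iter (n.*2 - fingraph.order f p) f p = p.
    apply: (@iter_inj (fingraph.order f p)); rewrite -iterD subnKC 1?ltnW //.
    by rewrite fix2 iter_order.
  move/(congr1 (findex f p)); rewrite findex0 findex_iter; last first.
    by rewrite ltn_subLR ?(ltnW lt) // addnn ltn_double.
  by apply/eqP; rewrite -lt0n subn_gt0.
move=> iq iq' nq nq'; have [n n2 ->] := half q pq iq nq.
have [m m2 ->] := half q' pq' iq' nq'.
by congr (iter _ f p); apply: double_inj; rewrite n2.
Qed.

(** If the orbit had odd order [2m + 1], then [k] would fix [i (f^m p)]; for order [2m] the antipode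
    [f^m p] is the second fixed point. *)
Lemma dih_fixed_ex p : (forall x, k x != x) -> i p = p ->
  exists q, [/\ connect dih p q, i q = q & q != p].
Proof.
move=> kF ip.
have fL := iter_order f_inj p.
have conn n : connect dih p (iter n f p).
  elim: n => //= n IHn; apply: connect_trans IHn _.
  apply: (@connect_trans _ _ (i (iter n f p))); apply: connect1.
    by rewrite /dih eqxx orbT.
  by rewrite /dih eqxx.
pose m := (fingraph.order f p)./2; have Lm : fingraph.order f p = odd (fingraph.order f p) + m.*2.
  by rewrite odd_double_half.
case: (boolP (odd (fingraph.order f p))) Lm => _ /= Lm.
  suff /eqP : k (i (iter m f p)) = i (iter m f p) by rewrite (negPf (kF _)).
  rewrite -[k _]/(iter m.+1 f p); apply: (@iter_inj m).
  by rewrite iter_i -iterD addnS addnn -add1n -Lm fL.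
exists (iter m f p); split=> //.
  by apply: (@iter_inj m); rewrite iter_i -iterD addnn -[m.*2]add0n -Lm fL ip.
apply/eqP=> /(congr1 (findex f p)); rewrite findex0.
have L0 := fingraph.order_gt0 f p; rewrite add0n in Lm.
have m0 : 0 < m by rewrite -double_gt0 -Lm.
rewrite findex_iter => [m00|]; first by rewrite m00 in m0.
by rewrite Lm -addnn -{1}[m]addn0 ltn_add2l.
Qed.

(** Without fixed points every component is an even cycle on which [k] and [i] alternate; its two
    classes are the orbits of [f]. *)
Lemma dih_bipartite : (forall x, k x != x) -> (forall x, i x != x) ->
  exists o : T -> bool, forall x, o (k x) = ~~ o x /\ o (i x) = ~~ o x.
Proof.
move=> kF iF; have sc := sym_connect_sym dih_sym.
pose rt x := fingraph.root dih x.
have rtk x : rt (k x) = rt x.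
  by apply/esym/(fingraph.rootP sc)/connect1; rewrite /dih eqxx.
have rti x : rt (i x) = rt x.
  by apply/esym/(fingraph.rootP sc)/connect1; rewrite /dih eqxx orbT.
pose o x := fconnect f (rt x) x; exists o.
have of_ x : o (f x) = o x by rewrite /o -same_fconnect1_r // /f rtk rti.
(* If [k x = f^n x], then [f^m x] with [m] half of [n], rounded down, is fixed by [k] or by [i],
   according to the parity of [n]. *)
have nk x : ~~ fconnect f x (k x).
  apply/negP=> /iter_findex; set n := findex _ _ _.
  rewrite -(odd_double_half n) -(iter_k n./2); case: (odd n).
    rewrite add1n -addnn -addnS iterD => /iter_inj/(inv_inj kK)/eqP.
    by rewrite (negPf (iF _)).
  by rewrite add0n -addnn iterD => /iter_inj/esym/eqP; rewrite (negPf (kF _)).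
suff ok x : o (k x) = ~~ o x.
  by move=> x; split=> //; rewrite -(of_ x) -[f x]/(k (i x)) ok negbK.
set r := rt x; have cl : invariant_fun dih
    (fun y => fconnect f r y || fconnect f r (k y)).
  apply/dih_invariantP; split=> y; rewrite ?kK orbC //.
  rewrite -[k (i y)]/(f y) -same_fconnect1_r //; congr orb.
  by rewrite (same_fconnect1_r f_inj) /f iK.
have := connect_invariant cl (connect_root dih x).
rewrite -[fingraph.root _ _]/r connect0 /= /o rtk -/r => /orP or_x.
apply/idP/idP => [rk | nr].
  apply/negP=> rx; case/negP: (nk x).
  by apply: connect_trans rk; rewrite fconnect_sym.
by case: or_x => // rx; rewrite rx in nr.
Qed.

End Dihedral.

(** * Arcs with four ends and their closures *)

Section Gluing.

Variables (T : finType) (k i0 : T -> T) (p1 p2 p3 p4 : T).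
Hypotheses (kK : involutive k) (i0K : involutive i0) (kF : forall x, k x != x).
Hypothesis fix0 : forall x, (i0 x == x) = (x \in [:: p1; p2; p3; p4]).
Hypothesis uniq4 : uniq [:: p1; p2; p3; p4].

Local Notation c := (connect (dih k i0)).

(** A component containing one of the four points is a path whose ends are exactly two of them. *)
Lemma pairing : [\/ [/\ c p1 p2, c p3 p4, ~~ c p1 p3 & ~~ c p1 p4],
  [/\ c p1 p3, c p2 p4, ~~ c p1 p2 & ~~ c p1 p4] |
  [/\ c p1 p4, c p2 p3, ~~ c p1 p2 & ~~ c p1 p3]].
Proof.
have sc : connect_sym (dih k i0) by apply: sym_connect_sym; apply: dih_sym.
have f0 x : x \in [:: p1; p2; p3; p4] -> i0 x = x by rewrite -fix0 => /eqP.
have in1 : p1 \in [:: p1; p2; p3; p4] by rewrite !inE eqxx.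
have in2 : p2 \in [:: p1; p2; p3; p4] by rewrite !inE eqxx !orbT.
have in3 : p3 \in [:: p1; p2; p3; p4] by rewrite !inE eqxx !orbT.
have in4 : p4 \in [:: p1; p2; p3; p4] by rewrite !inE eqxx !orbT.
have F1 := f0 _ in1; have F2 := f0 _ in2; have F3 := f0 _ in3; have F4 := f0 _ in4.
move: uniq4; rewrite /= !inE !negb_or andbT.
case/and3P=> /and3P[n12 n13 n14] /andP[n23 n24] n34.
have ex x : i0 x = x -> exists2 y, y \in [:: p1; p2; p3; p4] & c x y && (y != x).
  move=> ix; have [y [xy /eqP]] := dih_fixed_ex kK i0K kF ix.
  by rewrite fix0 => iy nyx; exists y; rewrite ?xy.
have un x y z : i0 x = x -> i0 y = y -> i0 z = z -> y != x -> z != x -> y != z ->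
    c x y -> ~~ c x z.
  move=> ix iy iz nyx nzx nyz xy; apply: contra nyz => xz; apply/eqP.
  exact: (dih_fixed_uniq kK i0K ix).
have [y] := ex _ F1; rewrite !inE => /or4P[]/eqP->; rewrite ?eqxx ?andbF // => /andP[c1 _].
- have c13 : ~~ c p1 p3 by apply: (un _ p2); rewrite // eq_sym.
  have c14 : ~~ c p1 p4 by apply: (un _ p2); rewrite // eq_sym.
  apply: Or31; split=> //; have [z] := ex _ F3.
  rewrite !inE => /or4P[]/eqP->; rewrite ?eqxx ?andbF //; last by case/andP.
    by rewrite sc (negPf c13).
  by rewrite sc -(same_connect sc c1) (negPf c13).
- have c12 : ~~ c p1 p2 by apply: (un _ p3); rewrite // eq_sym.
  have c14 : ~~ c p1 p4 by apply: (un _ p3); rewrite // eq_sym.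
  apply: Or32; split=> //; have [z] := ex _ F2.
  rewrite !inE => /or4P[]/eqP->; rewrite ?eqxx ?andbF //; last by case/andP.
    by rewrite sc (negPf c12).
  by rewrite sc -(same_connect sc c1) (negPf c12).
have c12 : ~~ c p1 p2 by apply: (un _ p4); rewrite // eq_sym.
have c13 : ~~ c p1 p3 by apply: (un _ p4); rewrite // eq_sym.
apply: Or33; split=> //; have [z] := ex _ F2.
rewrite !inE => /or4P[]/eqP->; rewrite ?eqxx ?andbF //.
- by rewrite sc (negPf c12).
- by case/andP.
by rewrite sc -(same_connect sc c1) (negPf c12).
Qed.

End Gluing.

Section Glue.

Variables (T : finType) (k i0 i : T -> T) (q1 q2 q3 q4 : T).
Hypotheses (kK : involutive k) (i0K : involutive i0) (iK : involutive i).
Hypothesis fix0 : forall x, (i0 x == x) = (x \in [:: q1; q2; q3; q4]).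
Hypothesis i_i0 : forall x, i0 x != x -> i x = i0 x.
Hypotheses (i12 : i q1 = q2) (i34 : i q3 = q4).

Local Notation r0 := (dih k i0).

(** [i] differs from [i0] only in exchanging [q1] with [q2] and [q3] with [q4]. *)
Lemma connect_glue :
  connect (dih k i) =2 connect (add_edge (add_edge r0 q1 q2) q3 q4).
Proof.
have i21 : i q2 = q1 by rewrite -i12 iK.
have i43 : i q4 = q3 by rewrite -i34 iK.
have s0 : symmetric r0 by apply: dih_sym.
have si : symmetric (dih k i) by apply: dih_sym.
have e1 x : connect (dih k i) x (i x) by apply: connect1; rewrite /dih eqxx orbT.
move=> x y; apply/idP/idP; apply: connect_sub => {}x {}y.
  case/orP=> /eqP->; first by apply: connect1; rewrite /add_edge /dih eqxx.
  case: (boolP (i0 x == x)) => [|nx]; last first.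
    by apply: connect1; rewrite /add_edge /dih i_i0 // eqxx orbT.
  rewrite fix0 !inE => /or4P[]/eqP->; apply: connect1;
    by rewrite /add_edge ?i12 ?i21 ?i34 ?i43 !eqxx ?orbT.
case/or3P=> [/or3P[]||].
- case/orP=> /eqP->; first by apply: connect1; rewrite /dih eqxx.
  case: (boolP (i0 x == x)) => [/eqP->|/i_i0<-]; [exact: connect0 | exact: e1].
- by case/andP=> /eqP-> /eqP->; rewrite -i12.
- by case/andP=> /eqP-> /eqP->; rewrite -i21.
- by case/andP=> /eqP-> /eqP->; rewrite -i34.
- by case/andP=> /eqP-> /eqP->; rewrite -i43.
Qed.

Lemma glue_connected x y : connect r0 x y -> connect (dih k i) x y.
Proof.
rewrite connect_glue; apply: connect_sub => u v uv.
by apply: connect1; rewrite /add_edge uv.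
Qed.

(** Each new edge closes an arc on itself and merges nothing. *)
Lemma glue_parallel : connect r0 q1 q2 -> connect r0 q3 q4 ->
  n_comp (dih k i) predT = n_comp r0 predT.
Proof.
move=> c12 c34; rewrite (eq_n_comp connect_glue).
have s0 : symmetric r0 by apply: dih_sym.
have := n_comp_add_edge q3 q4 (add_edge_sym q1 q2 s0).
rewrite (connect_sub _ c34) /= ?addn0 => [->|u v uv]; last first.
  by apply: connect1; rewrite /add_edge uv.
by have := n_comp_add_edge q1 q2 s0; rewrite c12 addn0.
Qed.

(** The first new edge merges the two arcs; the second then closes the merged arc. *)
Lemma glue_cross : ~~ connect r0 q1 q2 ->
  (connect r0 q1 q3 && connect r0 q2 q4) || (connect r0 q1 q4 && connect r0 q2 q3) ->
  (n_comp (dih k i) predT).+1 = n_comp r0 predT.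
Proof.
move=> n12 c; rewrite (eq_n_comp connect_glue).
have s0 : symmetric r0 by apply: dih_sym.
have s1 := add_edge_sym q1 q2 s0; have sc := sym_connect_sym s1.
have := n_comp_add_edge q3 q4 s1.
have sub u v : connect r0 u v -> connect (add_edge r0 q1 q2) u v.
  by apply: connect_sub => {}u {}v uv; apply: connect1; rewrite /add_edge uv.
have c12 : connect (add_edge r0 q1 q2) q1 q2.
  by apply: connect1; rewrite /add_edge !eqxx orbT.
have -> : connect (add_edge r0 q1 q2) q3 q4.
  case/orP: c => /andP[/sub c1 /sub c2].
    by rewrite -(same_connect sc c1) (connect_trans c12).
  rewrite sc -(same_connect sc c1); exact: connect_trans c2.
rewrite addn0 => ->.
by have := n_comp_add_edge q1 q2 s0; rewrite n12 addn1.
Qed.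

End Glue.

(** * Flags of a ribbon graph *)

Section FlagMaps.

Variable G : ribbon_graph.
Implicit Types (p : flag G) (e : edge G) (A : {set edge G}).

Definition edge_of p : edge G := p.1.1.

Definition corner p : flag G :=
  if p.2 then (Defs.rot G p.1, false) else ((Defs.rot G)^-1%g p.1, true).

(* At a ribbon the four flags are joined in pairs by one of three involutions:
   [dele] if the ribbon is absent, [face] if it is present and [cros] if it is
   present in the Petrie dual. *)
Definition dele p : flag G := (p.1, ~~ p.2).

Definition face p : flag G :=
  (opp_half p.1, if twisted p.1.1 then p.2 else ~~ p.2).

Definition cros p : flag G := dele (face p).

Lemma cornerK : involutive corner.
Proof. by case=> h []; rewrite /corner /= ?permK ?permKV. Qed.

Lemma deleK : involutive dele.
Proof. by case=> h b; rewrite /dele /= negbK. Qed.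

Lemma faceK : involutive face.
Proof. by case=> [[e c] b]; rewrite /face /opp_half /= negbK; case: twisted; rewrite ?negbK. Qed.

Lemma dele_face p : dele (face p) = face (dele p).
Proof. by case: p => [[e c] b]; rewrite /face /dele /=; case: twisted. Qed.

Lemma cros_dele p : cros (dele p) = face p.
Proof. by rewrite /cros -dele_face deleK. Qed.

Lemma crosK : involutive cros.
Proof. by move=> p; rewrite /cros -dele_face deleK faceK. Qed.

Lemma corner_neq p : corner p != p.
Proof. by apply/eqP=> /(congr1 snd); case: p => h []. Qed.

Lemma dele_neq p : dele p != p.
Proof. by apply/eqP=> /(congr1 snd); case: p => h []. Qed.

Lemma face_neq p : face p != p.
Proof. by apply/eqP=> /(congr1 (fun q => q.1.2)); case: p => [[e []] b]. Qed.

Lemma cros_neq p : cros p != p.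
Proof. by apply/eqP=> /(congr1 (fun q => q.1.2)); case: p => [[e []] b]. Qed.

Lemma dele_face_neq p : dele p != face p.
Proof. by apply/eqP=> /(congr1 (fun q => q.1.2)); case: p => [[e []] b]. Qed.

Lemma edge_ofP p q :
  (edge_of q == edge_of p) = (q \in [:: p; dele p; face p; cros p]).
Proof.
rewrite !inE /cros /face /dele /edge_of /opp_half.
case: p q => [[e c] b] [[e' c'] b'] /=; rewrite !xpair_eqE.
case: eqP => [_|_] //=.
by case: (twisted e); case: c; case: c'; case: b; case: b'.
Qed.

Lemma flags_uniq p : uniq [:: p; dele p; face p; cros p].
Proof.
rewrite /= !inE /cros !negb_or; rewrite ![p == _]eq_sym.
rewrite dele_neq face_neq cros_neq dele_face_neq /=.
by rewrite (inj_eq (inv_inj deleK)) [p == _]eq_sym face_neq eq_sym dele_neq.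
Qed.

Lemma end_arcE A p : end_arc A p = if edge_of p \in A then face p else dele p.
Proof. by case: p => [[e c] b]; rewrite /end_arc /face /dele /edge_of. Qed.

Lemma edge_end_arc A p : edge_of (end_arc A p) = edge_of p.
Proof. by rewrite end_arcE; case: ifP. Qed.

(** Boundary curves are thus dihedral orbits, of two involutions without fixed points. *)
Lemma boundary_adjE A : boundary_adj A =2 dih corner (end_arc A).
Proof.
move=> p q; rewrite /boundary_adj /dih orbA; congr (_ || _).
case: p q => [h b] [h' b']; rewrite /corner_arc /corner /=.
case: b b' => [] [] //=; rewrite xpair_eqE ?andbF ?orbF ?andbT //.
by rewrite -[RHS](inj_eq (@perm_inj _ (Defs.rot G))) permKV eq_sym.
Qed.

Definition num_loops A := n_comp (boundary_adj A) predT.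

Lemma num_loopsE A : num_loops A = n_comp (dih corner (end_arc A)) predT.
Proof. by apply: eq_n_comp; apply: eq_connect; apply: boundary_adjE. Qed.

Lemma att_corner p : att (corner p).1 = att p.1.
Proof.
case: p => [h []] /=; apply/eqP; rewrite att_rot.
  by rewrite porbit_sym; apply: (mem_porbit _ 1).
by rewrite -[X in X \in _](permKV (Defs.rot G)); apply: (mem_porbit _ 1).
Qed.

(** The half-edges at a vertex form one cycle of [rot], and [corner] followed by [dele] walks along
    it. *)
Lemma vertex_flag (S : eqType) (a : flag G -> S) p q :
  (forall p, a (corner p) = a p) -> (forall p, a (dele p) = a p) ->
  att p.1 = att q.1 -> a p = a q.
Proof.
move=> ak ad /eqP; rewrite att_rot => /porbitP[n].
have a1 h b : a (h, b) = a (h, true) by case: b => //; rewrite -ad.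
case: p q => [h b] [h' b'] /= ->; rewrite a1 [RHS]a1 {b b'}.
elim: n => [|n ->]; first by rewrite expg0 perm1.
by rewrite expgSr permM -[LHS]ak /corner /= a1.
Qed.

Lemma vertex_flag_connect p q : att p.1 = att q.1 -> connect (dih corner dele) p q.
Proof.
move=> pq; rewrite -(@vertex_flag _ (connect (dih corner dele) p) p q) //.
  have sc := sym_connect_sym (dih_sym cornerK deleK).
  by move=> r; apply/esym/(same_connect_r sc)/connect1; rewrite /dih eqxx.
have sc := sym_connect_sym (dih_sym cornerK deleK).
by move=> r; apply/esym/(same_connect_r sc)/connect1; rewrite /dih eqxx orbT.
Qed.

Lemma adj_flag A p : edge_of p \in A -> adj A (att p.1) (att (face p).1).
Proof. by move=> pA; apply/existsP; exists p.1; rewrite pA !eqxx. Qed.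

Lemma connect_adj A p q : connect (dih corner (end_arc A)) p q ->
  connect (adj A) (att p.1) (att q.1).
Proof.
case/connectP=> s; elim: s p => [|r s IHs] p /= => [_ -> //|].
case/andP=> /orP[]/eqP-> /IHs{}IHs /IHs; rewrite ?att_corner // end_arcE.
by case: ifP => // pA; apply/connect_trans/connect1/adj_flag.
Qed.

(** * The three smoothings at an edge *)

Section Smoothing.

Variables (e : edge G) (A : {set edge G}).

(** For [g := id] the curves are cut at [e]; [dele], [face] and [cros] are the three ways of closing
    them again. *)
Definition smooth (g : flag G -> flag G) p :=
  if edge_of p == e then g p else end_arc A p.

Lemma smoothK g : involutive g -> (forall p, edge_of (g p) = edge_of p) ->
  involutive (smooth g).
Proof.
move=> gK ge p; rewrite /smooth; case: (eqVneq (edge_of p) e) => [pe|/negPf pe].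
  by rewrite ge pe eqxx.
by rewrite edge_end_arc pe end_arcK.
Qed.

Variable p : flag G.
Hypothesis pe : edge_of p = e.

Let smoothNe g q : smooth id q != q -> smooth g q = smooth id q.
Proof. by rewrite /smooth; case: ifP => //; rewrite eqxx. Qed.

Let fix_id q : (smooth id q == q) = (q \in [:: p; dele p; face p; cros p]).
Proof.
rewrite -edge_ofP /smooth pe; case: (edge_of q =P e) => _; first exact: eqxx.
by rewrite end_arcE; case: ifP => _; rewrite ?(negPf (face_neq _)) ?(negPf (dele_neq _)).
Qed.

(** The same four flags, in the order in which [face] pairs them; [fix_id14] does this for
    [cros]. *)
Let fix_id13 q : (smooth id q == q) = (q \in [:: p; face p; dele p; cros p]).
Proof. by rewrite fix_id !inE; case: (q == dele p); case: (q == face p); rewrite ?orbT ?orbF. Qed.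

Let fix_id14 q : (smooth id q == q) = (q \in [:: p; cros p; dele p; face p]).
Proof. by rewrite fix_id !inE; case: (q == dele p); case: (q == face p); rewrite ?orbT ?orbF. Qed.

Let idK : involutive (smooth id). Proof. exact: smoothK. Qed.
Let sdK : involutive (smooth dele). Proof. exact: smoothK deleK _. Qed.
Let sfK : involutive (smooth face). Proof. exact: smoothK faceK _. Qed.
Let scK : involutive (smooth cros). Proof. exact: smoothK crosK _. Qed.

Let sE g q : edge_of q = e -> smooth g q = g q.
Proof. by rewrite /smooth => ->; rewrite eqxx. Qed.

(* Cutting the boundary curves at [e] leaves two arcs that pair up its four
   flags; the smoothing with this same pairing closes them to two curves, the
   other two to one. *)
Lemma smooth_trichotomy
    (nD := n_comp (dih corner (smooth dele)) predT)
    (nN := n_comp (dih corner (smooth face)) predT)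
    (nX := n_comp (dih corner (smooth cros)) predT) :
  [\/ nN.+1 = nD /\ nX.+1 = nD,
      [/\ connect (dih corner (smooth dele)) p (face p), nN = nD.+1 & nX = nD] |
      [/\ connect (dih corner (smooth dele)) p (face p), nN = nD & nX = nD.+1]].
Proof.
have sc := sym_connect_sym (dih_sym cornerK idK).
have d12 : smooth dele p = dele p by exact: sE.
have d34 : smooth dele (face p) = cros p by exact: sE.
have gD := glue_parallel cornerK idK sdK fix_id (smoothNe _) d12 d34.
have gD' := glue_cross cornerK idK sdK fix_id (smoothNe _) d12 d34.
have cD := glue_connected cornerK idK sdK fix_id (smoothNe _) d12 d34.
have f12 : smooth face p = face p by exact: sE.
have f34 : smooth face (dele p) = cros p by rewrite /cros dele_face; apply: sE.
have gN := glue_parallel cornerK idK sfK fix_id13 (smoothNe _) f12 f34.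
have gN' := glue_cross cornerK idK sfK fix_id13 (smoothNe _) f12 f34.
have x12 : smooth cros p = cros p by exact: sE.
have x34 : smooth cros (dele p) = face p.
  by rewrite -(cros_dele p); apply: sE.
have gX := glue_parallel cornerK idK scK fix_id14 (smoothNe _) x12 x34.
have gX' := glue_cross cornerK idK scK fix_id14 (smoothNe _) x12 x34.
move: gD gD' gN gN' gX gX'; rewrite -/nD -/nN -/nX.
set n0 := n_comp _ _; clearbody n0 nD nN nX => gD gD' gN gN' gX gX'.
have [[c12 c34 n13 n14]|[c13 c24 n12 n14]|[c14 c23 n12 n13]] :=
  pairing cornerK idK corner_neq fix_id (flags_uniq p).
- have c43 := c34; rewrite sc in c43; apply: Or31; rewrite gD //.
  by rewrite gN' ?gX' ?c12 ?c34 ?c43 ?orbT.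
- have c42 := c24; rewrite sc in c42; apply: Or32; split; first exact: cD.
    by rewrite gN // gD' ?c13 ?c24.
  by apply: succn_inj; rewrite gD' ?gX' ?c13 ?c24 ?c42 ?orbT.
have c32 := c23; rewrite sc in c32; apply: Or33; split.
- apply: connect_trans (cD _ _ c14) _; apply: connect1.
  have -> : face p = smooth dele (cros p) by rewrite sE ?pe // /cros deleK.
  by rewrite /dih eqxx orbT.
- by apply: succn_inj; rewrite gD' ?gN' ?c14 ?c23 ?c32 ?orbT.
by rewrite gX // gD' ?c14 ?c23 ?orbT.
Qed.

End Smoothing.

End FlagMaps.

(** * Monotonicity of the Euler genus *)

Lemma subset_mono (T : finType) (f : {set T} -> int) :
  (forall e (A : {set T}), e \notin A -> (f A <= f (e |: A))%R) ->
  forall A B : {set T}, A \subset B -> (f A <= f B)%R.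
Proof.
move=> f1 A B; have [n] := ubnP #|B|; elim: n B => // n IHn B.
rewrite ltnS => Bn AB; have [BA|/subsetPn[e eB eA]] := boolP (B \subset A).
  by have -> : A = B by apply/eqP; rewrite eqEsubset AB.
rewrite -(setD1K eB); apply: Order.le_trans (f1 e _ _); last by rewrite !inE eqxx.
apply: IHn; first by have := cardsD1 e B; rewrite eB; lia.
apply/subsetP=> x xA; rewrite !inE (subsetP AB) // andbT.
by apply: contraNneq eA => <-.
Qed.

Section Genus.

Variable G : ribbon_graph.
Implicit Types (A B : {set edge G}) (e : edge G).

Lemma eq_n_comp_dih (T : finType) (k i i' : T -> T) :
  i =1 i' -> n_comp (dih k i) predT = n_comp (dih k i') predT.
Proof.
by move=> ii'; apply: eq_n_comp; apply: eq_connect => x y; rewrite /dih ii'.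
Qed.

Lemma smooth_dele e A : e \notin A -> smooth e A (@dele G) =1 end_arc A.
Proof.
move=> /negPf eA p; rewrite /smooth; case: eqP => // pe.
by rewrite end_arcE pe eA.
Qed.

Lemma smooth_face e A : smooth e A (@face G) =1 end_arc (e |: A).
Proof. by move=> p; rewrite /smooth !end_arcE !inE; case: eqP. Qed.

Lemma num_loops_dele e A : e \notin A ->
  num_loops A = n_comp (dih (@corner G) (smooth e A (@dele G))) predT.
Proof. by move=> eA; rewrite num_loopsE; apply/esym/eq_n_comp_dih/smooth_dele. Qed.

Lemma num_loops_face e A :
  num_loops (e |: A) = n_comp (dih (@corner G) (smooth e A (@face G))) predT.
Proof. by rewrite num_loopsE; apply/esym/eq_n_comp_dih/smooth_face. Qed.

Definition num_isolated := #|[set v : vertex G | [forall h, att h != v]]|.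

Lemma num_bdryE A : num_bdry A = num_loops A + num_isolated.
Proof. by []. Qed.

Lemma num_comp_add e A :
  num_comp (e |: A) + ~~ connect (adj A) (att (e, true)) (att (e, false))
  = num_comp A.
Proof.
rewrite -[RHS](n_comp_add_edge (att (e, true)) (att (e, false)) (adj_sym A)).
congr (_ + _); apply: eq_n_comp; apply: eq_connect => x y.
rewrite /add_edge; apply/existsP/orP => [[[e' b]]|].
  rewrite !inE andb_orl => /orP[/and3P[/= /eqP-> /eqP<- /eqP<-]|]; last first.
    by move=> h; left; apply/existsP; exists (e', b).
  by right; case: b; rewrite /opp_half /= !eqxx ?orbT.
case=> [/existsP[h /andP[hA hh]]|].
  by exists h; rewrite hh inE hA orbT.
case/orP=> /andP[/eqP-> /eqP->]; [exists (e, true) | exists (e, false)];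
  by rewrite !inE /= !eqxx.
Qed.

(** The Euler genus of the spanning ribbon subgraph [(V(G), A)]. *)
Definition subgenus A : int :=
  (num_comp A).*2%:Z + #|A|%:Z - #|vertex G|%:Z - (num_bdry A)%:Z.

(** Either the ribbon merges two boundary curves, which makes up for a possible loss of one
    component, or both its ends lie on one curve; then the components stay the same and at most one
    curve is gained. *)
Lemma subgenus_add e A : e \notin A -> (subgenus A <= subgenus (e |: A))%R.
Proof.
move=> eA; rewrite /subgenus !num_bdryE cardsU1 eA (num_loops_dele eA) (num_loops_face e A).
have := num_comp_add e A.
set p : flag G := ((e, true), true).
have sub : connect (dih (@corner G) (smooth e A (@dele G))) p (face p) ->
    connect (adj A) (att (e, true)) (att (e, false)).
  move=> c; apply: (@connect_adj _ A p (face p)).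
  rewrite (eq_connect (e' := dih (@corner G) (smooth e A (@dele G)))) // => x y.
  by rewrite /dih (smooth_dele eA).
have := smooth_trichotomy A (erefl : edge_of p = e).
by case=> [[N X]|[c N X]|[c N X]]; rewrite ?(sub c); lia.
Qed.

Lemma subgenus_mono A B : A \subset B -> (subgenus A <= subgenus B)%R.
Proof. exact: subset_mono subgenus_add A B. Qed.

Lemma num_comp0 : num_comp (set0 : {set edge G}) = #|vertex G|.
Proof.
rewrite /num_comp -(fcard_id predT); apply: eq_n_comp => x y.
rewrite fconnect_id; apply/idP/eqP=> [|->]; last exact: connect0.
by case/connectP=> [[|z s]] //=; case/andP=> /existsP[h]; rewrite inE.
Qed.

(** Without ribbons all flags at a vertex lie on one curve. *)
Lemma subgenus0 : (0 <= subgenus set0)%R.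
Proof.
rewrite /subgenus num_comp0 cards0 num_bdryE num_loopsE.
suff : n_comp (dih (@corner G) (end_arc set0)) predT + num_isolated <= #|vertex G| by lia.
rewrite -(cardsC [set v : vertex G | [forall h, att h != v]]) addnC leq_add2l.
apply: leq_trans (n_comp_card_le (g := fun p : flag G => att p.1) _ _) _.
- exact: dih_sym (@cornerK G) (end_arcK _).
- move=> p q /vertex_flag_connect; apply: connect_sub => u v uv; apply: connect1.
  by move: uv; rewrite /dih end_arcE inE.
apply/subset_leq_card/subsetP=> _ /codomP[p ->]; rewrite !inE.
by apply/forallPn; exists p.1; rewrite negbK.
Qed.

Lemma subgenus_setT : connected G -> subgenus setT = euler_genus G.
Proof. by move=> c1; rewrite /subgenus /euler_genus c1 cardsT; lia. Qed.

Lemma euler_genus_ge0 : (0 <= euler_genus G)%R.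
Proof.
have := subgenus0; have := subgenus_mono (subsetT set0).
by rewrite /subgenus /euler_genus cardsT mulr2n; lia.
Qed.

(** The genus of [A] lies between that of [set0], which is nonnegative, and that of [G], which is 0;
    so Euler's formula holds for every [A]. *)
Lemma plane_num_bdry A : plane G ->
  (#|vertex G| + num_bdry A = (num_comp A).*2 + #|A|)%N.
Proof.
case=> c g; have := subgenus_mono (subsetT A); have := subgenus_mono (sub0set A).
have := subgenus0; rewrite subgenus_setT // g; rewrite /subgenus; lia.
Qed.

End Genus.

Local Open Scope ring_scope.

(** * Splitting flag valuations over F_2 *)

Section Matrices.

Variable T : finType.
Local Notation N := #|T|.
Local Notation M := 'M['F_2]_N.
Implicit Types (g h : T -> T) (u : 'rV['F_2]_N).

Lemma F2_addmm m n (A : 'M['F_2]_(m, n)) : A + A = 0.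
Proof.
by apply/matrixP=> i j; rewrite !mxE; case: (A i j) => -[|[|//]] /= ?; apply: val_inj.
Qed.

Definition fun_mx g : M := \matrix_(i, j) (g (enum_val i) == enum_val j)%:R.

Lemma fun_mxE u g (gK : involutive g) x :
  (u *m fun_mx g) 0 (enum_rank x) = u 0 (enum_rank (g x)).
Proof.
rewrite mxE (bigD1 (enum_rank (g x))) //= mxE !enum_rankK gK eqxx mulr1.
rewrite big1 ?addr0 // => i /negP ni; rewrite mxE enum_rankK.
case: eqP => [gi|]; last by rewrite mulr0.
by case: ni; apply/eqP/enum_val_inj; rewrite -gi enum_rankK gK.
Qed.

Lemma fun_mxM g h : fun_mx g *m fun_mx h = fun_mx (h \o g).
Proof.
apply/matrixP=> i j; rewrite !mxE (bigD1 (enum_rank (g (enum_val i)))) //=.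
rewrite !mxE enum_rankK eqxx mul1r big1 ?addr0 // => k /negP nk; rewrite !mxE.
case: eqP => [gi|]; last by rewrite mul0r.
by case: nk; rewrite gi enum_valK.
Qed.

Lemma eq_fun_mx g h : g =1 h -> fun_mx g = fun_mx h.
Proof. by move=> gh; apply/matrixP=> i j; rewrite !mxE gh. Qed.

Lemma fun_mx_id : fun_mx id = 1%:M.
Proof. by apply/matrixP=> i j; rewrite !mxE (inj_eq enum_val_inj). Qed.

Lemma fun_mxK g : involutive g -> fun_mx g *m fun_mx g = 1%:M.
Proof. by move=> gK; rewrite fun_mxM -fun_mx_id; apply: eq_fun_mx. Qed.

Lemma fun_mx_tr g : involutive g -> (fun_mx g)^T = fun_mx g.
Proof.
move=> gK; apply/matrixP=> i j; rewrite !mxE; congr (_%:R : 'F_2); congr nat_of_bool.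
by rewrite -(inj_eq (inv_inj gK)) gK eq_sym.
Qed.

(** For an involution [g] its left kernel over [F_2] consists of the [g]-invariant vectors, and its
    square is 0. *)
Definition delta g : M := 1%:M + fun_mx g.

Lemma deltaE u g x : involutive g ->
  (u *m delta g) 0 (enum_rank x) = u 0 (enum_rank x) + u 0 (enum_rank (g x)).
Proof. by move=> gK; rewrite mulmxDr mulmx1 mxE fun_mxE. Qed.

Lemma kermx_delta g u : involutive g ->
  reflect (forall x, u 0 (enum_rank (g x)) = u 0 (enum_rank x))
          (u <= kermx (delta g))%MS.
Proof.
move=> gK; apply: (iffP sub_kermxP) => [ug0 x | ug].
  rewrite -fun_mxE //; have /matrixP/(_ 0 (enum_rank x)) := ug0.
  rewrite mulmxDr mulmx1 !mxE => /(congr1 (+%R (u 0 (enum_rank x)))).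
  rewrite addrA; set a := u _ _; have /matrixP/(_ 0 (enum_rank x)) := F2_addmm u.
  by rewrite !mxE => ->; rewrite add0r addr0.
apply/matrixP=> i j; rewrite mulmxDr mulmx1 ord1 -(enum_valK j) mxE fun_mxE // ug.
by rewrite !enum_valK -[RHS](congr1 (fun A : 'rV_N => A 0 j) (F2_addmm u)) mxE.
Qed.

Lemma deltaC g h : (forall x, g (h x) = h (g x)) ->
  delta g *m delta h = delta h *m delta g.
Proof.
move=> gh; rewrite /delta !mulmxDl !mulmxDr !mulmx1 !mul1mx !fun_mxM.
rewrite -!addrA; congr (_ + _); rewrite addrCA; congr (_ + (_ + _)).
by apply: eq_fun_mx => x /=; rewrite gh.
Qed.

Lemma delta2 g : involutive g -> delta g *m delta g = 0.
Proof.
move=> gK; rewrite /delta mulmxDl mul1mx mulmxDr mulmx1 fun_mxK //.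
by rewrite [X in _ + X]addrC F2_addmm.
Qed.

Definition ind_mx (s : T -> bool) : M :=
  \matrix_(i, j) ((i == j) && s (enum_val i))%:R.

Lemma ind_mxM s g i j :
  (ind_mx s *m fun_mx g) i j = ((g (enum_val i) == enum_val j) && s (enum_val i))%:R.
Proof.
rewrite mxE (bigD1 i) //= !mxE eqxx /= big1 ?addr0.
  by case: (s _); case: (_ == _); rewrite ?mulr1 ?mul1r ?mulr0 ?mul0r.
by move=> k /negPf ki; rewrite !mxE eq_sym ki mul0r.
Qed.

Lemma mul_fun_ind s g i j :
  (fun_mx g *m ind_mx s) i j = ((g (enum_val i) == enum_val j) && s (enum_val j))%:R.
Proof.
rewrite mxE (bigD1 j) //= !mxE eqxx /= big1 ?addr0.
  by case: (s _); case: (_ == _); rewrite ?mulr1 ?mul1r ?mulr0 ?mul0r.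
by move=> k /negPf ki; rewrite !mxE ki mulr0.
Qed.

(** [ind_mx s] acts as a contracting homotopy: for an involution the right side is invertible, which
    bounds the rank of [delta g] from below. *)
Lemma delta_ind_flip s g : (forall x, s (g x) = ~~ s x) ->
  delta g *m ind_mx s + ind_mx s *m delta g = fun_mx g.
Proof.
move=> sg; rewrite /delta mulmxDl mulmxDr mul1mx mulmx1.
rewrite addrACA F2_addmm add0r.
apply/matrixP=> i j; rewrite mxE mul_fun_ind ind_mxM mxE.
by case: eqP => [<-|]; rewrite ?addr0 // sg; case: (s _); rewrite ?addr0 ?add0r.
Qed.

Lemma delta_ind_comm s g : (forall x, s (g x) = s x) ->
  delta g *m ind_mx s = ind_mx s *m delta g.
Proof.
move=> sg; rewrite /delta mulmxDl mulmxDr mul1mx mulmx1; congr (_ + _).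
by apply/matrixP=> i j; rewrite mul_fun_ind ind_mxM; case: eqP => [<-|]; rewrite ?sg.
Qed.

Lemma fun_mx_unit g : involutive g -> fun_mx g \in unitmx.
Proof. by move/fun_mxK/mulmx1_unit=> []. Qed.

Lemma rank_delta s g : involutive g -> (forall x, s (g x) = ~~ s x) ->
  (N <= (\rank (delta g)).*2)%N.
Proof.
move=> gK sg; rewrite -{1}(mxrank_unit (fun_mx_unit gK)) -(delta_ind_flip sg).
apply: leq_trans (mxrank_add _ _) _; rewrite -addnn leq_add //.
  exact: mxrankM_maxl.
exact: mxrankM_maxr.
Qed.

End Matrices.

(* The right side has rank at least [N / 4 + 1].  The left side has at most this
   rank, because [A *m (D *m B)] has the same rank as its transpose
   [D *m B *m A]. *)
Lemma kermx_split (F : fieldType) (N : nat) (A B D : 'M[F]_N) :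
    A *m A = 0 -> B *m B = 0 -> D *m D = 0 -> D *m B = B *m D ->
    A^T = A -> B^T = B -> D^T = D ->
    (N <= (\rank A).*2)%N -> (N <= (\rank D).*2)%N ->
    (\rank D <= (\rank (D *m B)).*2)%N ->
    (\rank (kermx A :&: (kermx D :&: kermx B)) <= 1)%N ->
    (N + 8 <= 4 * (\rank (kermx A :&: kermx D) + \rank (kermx A :&: kermx B)))%N ->
  (kermx A :&: kermx (D *m B)
     <= (kermx A :&: kermx D) + (kermx A :&: kermx B))%MS.
Proof.
move=> A2 B2 D2 DB At Bt Dt rA rD rDB r1 rKK.
set KD := (kermx A :&: kermx D)%MS; set KB := (kermx A :&: kermx B)%MS.
have KDA : (KD <= kermx A)%MS by apply: capmxSl.
have KDD : (KD <= kermx D)%MS by apply: capmxSr.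
have KBA : (KB <= kermx A)%MS by apply: capmxSl.
have KBB : (KB <= kermx B)%MS by apply: capmxSr.
have le : (KD + KB <= kermx A :&: kermx (D *m B))%MS.
  rewrite addsmx_sub !sub_capmx KDA KBA /=; apply/andP; split; apply/sub_kermxP.
    by rewrite mulmxA (sub_kermxP KDD) mul0mx.
  by rewrite DB mulmxA (sub_kermxP KBB) mul0mx.
rewrite -(mxrank_leqif_sup le) eqn_leq (mxrankS le) /=.
have rc : (\rank (KD :&: KB) <= 1)%N.
  apply: leq_trans r1; apply: mxrankS; rewrite !sub_capmx.
  rewrite (submx_trans _ KDA) ?capmxSl // (submx_trans _ KDD) ?capmxSl //.
  by rewrite (submx_trans _ KBB) ?capmxSr.
(* The rows of [D *m B] are killed by both [D] and [B], which commute and square to 0. *)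
have r2 : (\rank (D *m B :&: kermx A) <= 1)%N.
  apply: leq_trans r1; apply: mxrankS; rewrite capmxC capmxS // sub_capmx.
  apply/andP; split; apply/sub_kermxP; last by rewrite -mulmxA B2 mulmx0.
  by rewrite DB -mulmxA D2 mulmx0.
have rAE : (\rank (A *m (D *m B)) <= \rank (kermx A *m (D *m B)))%N.
  by apply/mxrankS/submxMr/sub_kermxP.
have rEA : \rank (A *m (D *m B)) = \rank (D *m B *m A).
  by rewrite -mxrank_tr !trmx_mul At Bt Dt -DB.
have := mxrank_sum_cap KD KB; have := mxrank_mul_ker (kermx A) (D *m B).
rewrite mxrank_ker; have := mxrank_mul_ker (D *m B) A; have := rank_leq_row A.
rewrite -/KD -/KB in rKK.
by rewrite rEA in rAE; move: rAE rc r2 rA rD rDB rKK; clear; lia.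
Qed.

Section Split.

Variables (T : finType) (k d n : T -> T) (s q : T -> bool).
Hypotheses (kK : involutive k) (dK : involutive d) (nK : involutive n).
Hypothesis dn : forall x, d (n x) = n (d x).
Hypotheses (sk : forall x, s (k x) = ~~ s x) (sd : forall x, s (d x) = ~~ s x).
Hypotheses (qn : forall x, q (n x) = ~~ q x) (qd : forall x, q (d x) = q x).
Hypothesis conn : forall y : T -> bool, (forall x, y (k x) = y x) ->
  (forall x, y (d x) = y x) -> (forall x, y (n x) = y x) -> forall x x', y x = y x'.
(** For a plane graph this is Euler's formula [v + f = |E| + 2] times 4, as there are [4|E|]
    flags. *)
Hypothesis euler :
  (#|T| + 8 <= 4 * (n_comp (dih k d) predT + n_comp (dih k n) predT))%N.

Local Notation N := #|T|.
Local Notation K := (kermx (delta k)).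
Local Notation KD := (kermx (delta k) :&: kermx (delta d))%MS.
Local Notation KN := (kermx (delta k) :&: kermx (delta n))%MS.
Local Notation E := (delta d *m delta n).

(** A row space of rank [m] over [F_2] has [2^m] elements, and the invariant boolean functions embed
    in it. *)
Let rank_inv (g : T -> T) : involutive g ->
  (n_comp (dih k g) predT <= \rank (kermx (delta k) :&: kermx (delta g)))%N.
Proof.
move=> gK; set A := (_ :&: _)%MS.
have cA : #|rowg A| = (2 ^ \rank A)%N by rewrite card_rowg card_Fp.
have := card_inv_funs [set: bool] (dih_sym kK gK); rewrite cardsT card_bool => cI.
suff : (2 ^ n_comp (dih k g) predT <= 2 ^ \rank A)%N by rewrite leq_exp2l.
rewrite -cA -cI.
pose r (y : {ffun T -> bool}) : 'rV['F_2]_N := \row_j (y (enum_val j))%:R.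
have r_inj : injective r.
  move=> y y' /matrixP eqr; apply/ffunP=> x; have := eqr 0 (enum_rank x).
  by rewrite !mxE enum_rankK; case: (y x); case: (y' x).
rewrite -(card_imset _ r_inj); apply/subset_leq_card/subsetP=> _ /imsetP[y yP ->].
have [_ /dih_invariantP[yk yg]] := inv_funsP _ _ _ yP.
rewrite mem_rowg sub_capmx; apply/andP; split; apply/kermx_delta => // x.
  by rewrite !mxE !enum_rankK yk.
by rewrite !mxE !enum_rankK yg.
Qed.

Let rank_const : (\rank (kermx (delta k) :&: (kermx (delta d) :&: kermx (delta n))) <= 1)%N.
Proof.
apply: (@leq_trans (\rank (const_mx 1 : 'rV['F_2]_N))); last exact: rank_leq_row.
apply/mxrankS/row_subP=> i.
move: (row i _) (row_sub i (kermx (delta k) :&: (kermx (delta d) :&: kermx (delta n)))%MS) => u.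
rewrite !sub_capmx => /and3P[/(kermx_delta _ kK) uk /(kermx_delta _ dK) ud /(kermx_delta _ nK) un].
pose y x := u 0 (enum_rank x) == 1.
have cy : forall x x', y x = y x'.
  by apply: conn => x; rewrite /y ?uk ?ud ?un.
have F2E (z : 'F_2) : z = (z == 1)%:R.
  by case: z => -[|[|//]] /= ?; apply: val_inj.
have -> : u = (u 0 i) *: const_mx 1; last exact: scalemx_sub.
apply/matrixP=> a j; rewrite ord1 !mxE mulr1.
rewrite [LHS]F2E [RHS]F2E; congr (_%:R).
by have := cy (enum_val j) (enum_val i); rewrite /y !enum_valK => ->.
Qed.

Lemma split_rank : (kermx (delta k) :&: kermx (delta d *m delta n)
  <= (kermx (delta k) :&: kermx (delta d)) + (kermx (delta k) :&: kermx (delta n)))%MS.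
Proof.
have tr g : involutive g -> (delta g : 'M_N)^T = delta g.
  by move=> gK; rewrite /delta linearD /= trmx1 fun_mx_tr.
apply: kermx_split; rewrite ?tr ?delta2 //.
- exact: deltaC.
- exact: rank_delta kK sk.
- exact: rank_delta dK sd.
(* The homotopy [ind_mx q] for [n] commutes with [delta d], so [delta d] times an invertible matrix
   is a sum of two matrices of rank at most that of [delta d *m delta n]. *)
- have <- : \rank (delta d *m fun_mx n) = \rank (delta d).
    by apply: mxrankMfree; rewrite row_free_unit fun_mx_unit.
  have -> : delta d *m fun_mx n
      = (delta d *m delta n) *m ind_mx q + ind_mx q *m (delta d *m delta n).
    by rewrite -(delta_ind_flip qn) mulmxDr !mulmxA delta_ind_comm.
  apply: leq_trans (mxrank_add _ _) _; rewrite -addnn leq_add //.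
    exact: mxrankM_maxl.
  exact: mxrankM_maxr.
by apply: leq_trans euler _; rewrite leq_mul2l leq_add // rank_inv.
Qed.

(** The condition on sums says that [x], as a row vector, is killed by [delta d *m delta n];
    [split_rank] then decomposes it. *)
Lemma flag_split (x : T -> bool) : (forall p, x (k p) = x p) ->
  (forall p, x p (+) x (d p) (+) x (n p) (+) x (d (n p)) = false) ->
  exists a b : T -> bool,
  [/\ forall p, a (k p) = a p, forall p, a (d p) = a p,
      forall p, b (k p) = b p, forall p, b (n p) = b p &
      forall p, x p = a p (+) b p].
Proof.
move=> xk x0; pose u : 'rV['F_2]_N := \row_j (x (enum_val j))%:R.
have natb (b c : bool) : b%:R + c%:R = (b (+) c)%:R :> 'F_2.
  by case: b; case: c; apply: val_inj.
have uK : (u <= kermx (delta k) :&: kermx (delta d *m delta n))%MS.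
  rewrite sub_capmx; apply/andP; split.
    by apply/kermx_delta=> // p; rewrite !mxE !enum_rankK xk.
  apply/sub_kermxP/rowP=> j; rewrite -(enum_valK j) mulmxA /delta.
  rewrite !deltaE // !mxE !enum_rankK !natb addbA.
  by rewrite x0.
have /sub_addsmxP[[v w] /= uE] := submx_trans uK split_rank.
have : (v *m KD <= KD)%MS by apply: submxMl.
have : (w *m KN <= KN)%MS by apply: submxMl.
move: (v *m _) (w *m _) uE => {}v {}w uE; rewrite !sub_capmx.
case/andP=> /(kermx_delta _ kK) wk /(kermx_delta _ nK) wn.
case/andP=> /(kermx_delta _ kK) vk /(kermx_delta _ dK) vd.
pose f (t : 'rV['F_2]_N) p := t 0 (enum_rank p) == 1.
exists (f v), (f w); split=> p; rewrite /f ?vk ?vd ?wk ?wn //.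
have F2E (z : 'F_2) : z = (z == 1)%:R.
  by case: z => -[|[|//]] /= ?; apply: val_inj.
have : (x p)%:R = ((v 0 (enum_rank p) == 1) (+) (w 0 (enum_rank p) == 1))%:R :> 'F_2.
  rewrite -natb -!F2E; have /matrixP/(_ 0 (enum_rank p)) := uE.
  by rewrite !mxE enum_rankK.
by case: (x p); case: (_ (+) _).
Qed.
End Split.

(** * The evaluation at -2 *)

Lemma sum_set_add (V : nmodType) (T : finType) (e : T) (f : {set T} -> V) :
  \sum_(A : {set T}) f A = \sum_(A : {set T} | e \notin A) (f A + f (e |: A)).
Proof.
rewrite big_split /= (bigID (fun A : {set T} => e \notin A)) /=; congr (_ + _).
rewrite (reindex_onto (fun A : {set T} => e |: A) (fun A => A :\ e)) /=; last first.
  by move=> A; rewrite negbK => eA; rewrite setD1K.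
apply: eq_bigl => A; rewrite setU11 /=; apply/eqP/idP => [<-|/setU1K//].
by rewrite !inE eqxx.
Qed.

(** Expand the product of the factors [1 - p e]. *)
Lemma sum_sign_set (R : comNzRingType) (T : finType) (p : pred T) :
  \sum_(A : {set T}) (-1) ^+ #|A| * [forall e in A, p e]%:R
  = [forall e, ~~ p e]%:R :> R.
Proof.
transitivity (\prod_(e : T) (- (p e)%:R + 1) : R); last first.
  rewrite [LHS](_ : _ = \prod_(e : T) (~~ p e)%:R); last first.
    by apply: eq_bigr => e _; case: (p e); rewrite /= ?addNr // oppr0 add0r.
  case: (boolP [forall e, ~~ p e]) => [/forallP np|/forallPn[e /negPn pe]].
    by rewrite big1 // => e _; rewrite np.
  by rewrite (bigD1 e) //= pe mul0r.
rewrite bigA_distr; apply: eq_bigr => A _.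
rewrite [RHS](bigID (mem A)) /= [X in _ = _ * X]big1 ?mulr1; last first.
  by move=> e /negPf->.
rewrite (eq_bigr (fun e => -1 * (p e)%:R)) => [|e eA]; last by rewrite eA mulN1r.
rewrite big_split /= prodr_const; congr (_ * _).
case: (boolP [forall e in A, p e]) => [/forall_inP pA|].
  by rewrite big1 // => e eA; rewrite pA.
by case/forall_inPn=> e eA /negPf pe; rewrite (bigD1 e) //= pe mul0r.
Qed.

(** [f B A] is the term of [A] once the edges of [B] have been untwisted. The weighted sum stays the
    same when one more edge is untwisted. *)
Lemma exchange_recurrence (R : comNzRingType) (T : finType)
    (f : {set T} -> {set T} -> R) :
  (forall e (A B : {set T}), e \notin A -> e \notin B -> f (e |: B) A = f B A) ->
  (forall e (A B : {set T}), e \notin A -> e \notin B ->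
     f B A - f B (e |: A) = 2 * f B A + f (e |: B) (e |: A)) ->
  \sum_(A : {set T}) (-1) ^+ #|A| * f set0 A
  = \sum_(A : {set T}) 2 ^+ #|~: A| * f setT A.
Proof.
move=> fA fE.
(* An edge outside [B] weighs 1 if absent from [A] and -1 if present; an edge of [B] weighs 2 if
   absent and 1 if present. *)
pose w (B A : {set T}) : R := (-1) ^+ #|A :\: B| * 2 ^+ #|B :\: A|.
pose S B := \sum_(A : {set T}) w B A * f B A.
have UD e (A B : {set T}) : e \notin B -> (e |: A) :\: B = e |: (A :\: B).
  by move=> eB; apply/setP=> x; rewrite !inE; case: eqP => // ->; rewrite eB.
have DU e (A B : {set T}) : e \notin B -> B :\: (e |: A) = B :\: A.
  move=> eB; apply/setP=> x; rewrite !inE negb_or; case: eqP => //= ->.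
  by rewrite (negPf eB) andbF.
have UU e (A B : {set T}) : e \notin A -> (e |: A) :\: (e |: B) = A :\: B.
  move=> eA; apply/setP=> x; rewrite !inE negb_or; case: eqP => //= ->.
  by rewrite (negPf eA) andbF.
have S1 e (B : {set T}) : e \notin B -> S (e |: B) = S B.
  move=> eB; rewrite [LHS](sum_set_add e) [RHS](sum_set_add e).
  apply: eq_bigr => A eA; rewrite fA //.
  have -> : w (e |: B) A = 2 * w B A.
    by rewrite /w UD // DU // cardsU1 inE (negPf eB) andbF /= exprS mulrCA.
  have -> : w (e |: B) (e |: A) = w B A by rewrite /w !UU.
  have -> : w B (e |: A) = - w B A.
    by rewrite /w UD // DU // cardsU1 inE (negPf eA) andbF /= exprS mulN1r mulNr.
  rewrite mulNr -mulrBr fE // mulrDr; congr (_ + _).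
  by rewrite -mulrA mulrCA.
have Sall (B : {set T}) : S set0 = S B.
  have [n] := ubnP #|B|; elim: n B => // n IHn B; rewrite ltnS => Bn.
  have [->//|[e eB]] := set_0Vmem B.
  rewrite -(setD1K eB) S1 ?inE ?eqxx //; apply: IHn.
  by have := cardsD1 e B; rewrite eB; lia.
transitivity (S set0).
  by apply: eq_bigr => A _; rewrite /w setD0 set0D cards0 mulr1.
rewrite (Sall setT); apply: eq_bigr => A _.
by rewrite /w setDT cards0 mul1r setTD.
Qed.

(** * The binor identity and the chromatic expansion *)

Section Binor.

Variable G : ribbon_graph.
Implicit Types (A B : {set edge G}) (e : edge G) (t : edge G -> bool).

Definition retwist t := RibbonGraph t (@att_rot G).

Let loops t A : nat := @num_loops (retwist t) A.

Lemma eq_num_loops t t' A : (forall e, e \in A -> t e = t' e) -> loops t A = loops t' A.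
Proof.
move=> tt'; rewrite /loops !num_loopsE; apply: eq_n_comp_dih => p.
rewrite !end_arcE; case: ifP => // pA; rewrite /face /=.
by have -> : t p.1.1 = t' p.1.1 by apply: tt'.
Qed.

Lemma num_loops_cros t t' e A : t' e = ~~ t e ->
    (forall e', e' \in A -> t e' = t' e') -> e \notin A ->
  loops t' (e |: A)
  = n_comp (dih (@corner (retwist t)) (@smooth (retwist t) e A (@cros (retwist t)))) predT.
Proof.
move=> te tt' eA; rewrite /loops num_loopsE; apply: eq_n_comp_dih => p.
rewrite end_arcE /smooth !inE; case: eqP => [pe|_] /=.
  rewrite /cros /face /dele /= -[p.1.1]/(edge_of p : edge G) pe te.
  by case: (t e); rewrite ?negbK.
rewrite end_arcE; case: ifP => // pA; rewrite /face /=.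
by have -> : t p.1.1 = t' p.1.1 by apply: tt'.
Qed.

(** By [smooth_trichotomy] two of the exponents are equal and the third is larger by one; and
    [1 + 1 - 2 = 0]. *)
Lemma binor t t' e A : e \notin A -> t' e = ~~ t e ->
    (forall e', e' \in A -> t e' = t' e') ->
  (-2 : rat) ^+ loops t A + (-2) ^+ loops t (e |: A) + (-2) ^+ loops t' (e |: A) = 0.
Proof.
move=> eA te tt'; rewrite (num_loops_cros te tt' eA) /loops.
rewrite (@num_loops_dele (retwist t) e A eA) (@num_loops_face (retwist t) e A).
have := @smooth_trichotomy (retwist t) e A ((e, true), true) (erefl e).
move: (n_comp _ _) (n_comp _ _) (n_comp _ _) => nD nN nX.
by case=> [[<- [->]]|[_ -> ->]|[_ -> ->]]; rewrite exprS; ring.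
Qed.

Lemma binor_expansion :
  \sum_(A : {set edge G}) (-1) ^+ #|A| * (-2 : rat) ^+ @num_bdry (petrie_dual G) A
  = \sum_(A : {set edge G}) 2 ^+ #|~: A| * (-2) ^+ num_bdry A.
Proof.
(* Edges outside [B] carry the extra half-twist, so [tw set0] belongs to the Petrie dual and
   [tw setT] to [G]. *)
pose tw (B : {set edge G}) e := twisted e (+) (e \notin B).
pose f B A : rat := (-2) ^+ (loops (tw B) A + num_isolated G)%N.
have tA e A B : e \notin A -> forall e', e' \in A -> tw (e |: B) e' = tw B e'.
  move=> eA e' e'A; rewrite /tw !inE; case: eqP => // ee'.
  by rewrite -ee' e'A in eA.
have bX A : @num_bdry (petrie_dual G) A = (loops (tw set0) A + num_isolated G)%N.
  have tE e : e \in A -> ~~ twisted e = tw set0 e by rewrite /tw inE addbT.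
  by rewrite -(eq_num_loops tE); apply: (@num_bdryE (petrie_dual G) A).
have bN A : num_bdry A = (loops (tw setT) A + num_isolated G)%N.
  have tE e : e \in A -> twisted e = tw setT e by rewrite /tw inE addbF.
  by rewrite -(eq_num_loops tE); apply: (@num_bdryE (retwist _) A).
transitivity (\sum_(A : {set edge G}) (-1) ^+ #|A| * f set0 A).
  by apply: eq_bigr => A _; rewrite bX /f.
rewrite [RHS](eq_bigr (fun A => 2 ^+ #|~: A| * f setT A)) => [|A _]; last by rewrite bN /f.
apply: exchange_recurrence.
- by move=> e A B eA _; rewrite /f (eq_num_loops (tA e A B eA)).
move=> e A B eA eB; rewrite /f.
have te : tw B e = ~~ tw (e |: B) e by rewrite /tw !inE eqxx eB; case: twisted.
have alg (a b c i : nat) :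
    (-2 : rat) ^+ a + (-2) ^+ b + (-2) ^+ c = 0 ->
    (-2 : rat) ^+ (a + i) - (-2) ^+ (c + i) = 2 * (-2) ^+ (a + i) + (-2) ^+ (b + i).
  rewrite !exprD; move: (_ ^+ a) (_ ^+ b) (_ ^+ c) (_ ^+ i) => x y z w xyz.
  have -> : z = - (x + y) by apply/eqP; rewrite -addr_eq0 addrC xyz.
  ring.
rewrite -(eq_num_loops (tA e A B eA)); apply: alg.
exact: binor eA te (tA e A B eA).
Qed.

End Binor.

(** [4 ^+ num_comp A] counts the colourings constant along the edges of [A]; inclusion-exclusion
    leaves the proper ones. *)
Lemma sum_colourings (G : ribbon_graph) :
  \sum_(A : {set edge G}) (-1) ^+ #|A| * 4 ^+ num_comp A
  = #|[set col : {ffun vertex G -> 'I_4} |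
        [forall e, col (att (e, false)) != col (att (e, true))]]|%:R :> rat.
Proof.
rewrite -sum1_card natr_sum [RHS]big_mkcond /=.
transitivity (\sum_(A : {set edge G}) (-1) ^+ #|A| * \sum_(col : {ffun vertex G -> 'I_4})
    [forall e in A, col (att (e, false)) == col (att (e, true))]%:R : rat).
  apply: eq_bigr => A _; congr (_ * _); rewrite -natrX -natr_sum; congr (_%:R).
  have := card_inv_funs [set: 'I_4] (adj_sym A); rewrite cardsT card_ord => <-.
  rewrite -sum1_card big_mkcond; apply: eq_bigr => col _ /=.
  case: ifPn => [/inv_funsP[_ inv]|ninv].
    rewrite (_ : [forall _ in _, _]) //; apply/forall_inP=> e eA; apply/eqP/inv.
    by apply/existsP; exists (e, false); rewrite eA /= !eqxx.
  case: forall_inP => // inv; case/negP: ninv; apply/inv_funsP; split=> [v|u v].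
    by rewrite inE.
  case/existsP=> -[e b] /and3P[/= eA /eqP<- /eqP<-].
  by have /eqP := inv e eA; case: b.
under [LHS]eq_bigr do rewrite mulr_sumr.
rewrite exchange_big /=; apply: eq_bigr => col _.
by rewrite sum_sign_set inE; case: ifP.
Qed.

(** This is the sum [P(l)]. *)
Definition alternating_loops (G : ribbon_graph) (l : rat) : rat :=
  \sum_(A : {set edge G}) (-1) ^+ #|A| * l ^+ @num_bdry (petrie_dual G) A.

(** The powers of [y] combine to [y ^ (f - 1)], and the sign has the parity of [v + a + f]. *)
Lemma ribbon_term (y : rat) (v a c f : nat) : y != 0 ->
  y ^ (c%:Z - 1) * y ^ (a%:Z - (v%:Z - c%:Z))
    * (- y^-1) ^ (c%:Z - f%:Z + (a%:Z - (v%:Z - c%:Z)))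
  = (-1) ^+ v * y^-1 * ((-1) ^+ a * (- y) ^+ f).
Proof.
move=> y0; have N0 : (-1 : rat) != 0 by rewrite oppr_eq0 oner_eq0.
have sqN (n : nat) : (-1 : rat) ^ (- n%:Z) = (-1) ^+ n.
  by rewrite -exprz_inv invrN1.
rewrite -[- y^-1]mulN1r exprzMl ?unitfE ?invr_eq0 // exprz_inv.
rewrite mulrCA -!expfzDr //.
have -> : c%:Z - 1 + (a%:Z - (v%:Z - c%:Z))
    + - (c%:Z - f%:Z + (a%:Z - (v%:Z - c%:Z))) = f%:Z + (-1) by lia.
have -> : c%:Z - f%:Z + (a%:Z - (v%:Z - c%:Z))
    = c%:Z + c%:Z + a%:Z + (- v%:Z) + (- f%:Z) by lia.
rewrite !expfzDr // !sqN -exprnP -expr2 sqrr_sign mul1r [(- y) ^+ f]exprNn.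
by rewrite -!exprnP exprN1; ring.
Qed.

Lemma ribbon_poly_petrie (G : ribbon_graph) (y : rat) : connected G -> y != 0 ->
  (-1) ^+ #|vertex G| * ribbon_poly (petrie_dual G) (y + 1) y (- y^-1)
  = y^-1 * alternating_loops G (- y).
Proof.
move=> cG y0; rewrite /alternating_loops /ribbon_poly mulr_sumr mulr_sumr.
apply: eq_bigr => A _; rewrite addrK /nullity /rank.
have -> : @num_comp (petrie_dual G) setT = 1%N by [].
set v := #|vertex _|; set c := num_comp A.
have -> : v%:Z - 1%N%:Z - (v%:Z - c%:Z) = c%:Z - 1 by lia.
rewrite ribbon_term //.
by rewrite !mulrA -expr2 sqrr_sign mul1r.
Qed.

(** By Euler's formula [(-2)^(v + f(A)) = 4^c(A) (-2)^|A|]; the factors 2 of the edges outside [A]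
    complete [2^|E|]. *)
Lemma alternating_loops_m2 (G : ribbon_graph) : plane G ->
  (-2) ^+ #|vertex G| * alternating_loops G (-2)
  = 2 ^+ #|edge G| * #|[set col : {ffun vertex G -> 'I_4} |
        [forall e, col (att (e, false)) != col (att (e, true))]]|%:R.
Proof.
move=> pG; rewrite /alternating_loops binor_expansion mulr_sumr -sum_colourings mulr_sumr.
apply: eq_bigr => A _; rewrite mulrCA -exprD plane_num_bdry //.
have -> : #|edge G| = (#|A| + #|~: A|)%N by rewrite cardsC.
move: #|A| #|~: A| (num_comp A) => a b c.
rewrite !exprD -mul2n exprM sqrrN -[2 ^+ 2]/(4 : rat) -mulN1r exprMn.
ring.
Qed.

Lemma alternating_loops_m2_neq0 (G : ribbon_graph) : plane G ->
  alternating_loops G (-2) != 0 <->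
  exists col : vertex G -> 'I_4, proper_colouring col.
Proof.
move=> pG; have E := alternating_loops_m2 pG.
set S := [set _ | _] in E.
have -> : (alternating_loops G (-2) != 0) = (S != set0).
  have p2 : (-2 : rat) ^+ #|vertex G| != 0 by rewrite expf_neq0.
  have q2 : (2 : rat) ^+ #|edge G| != 0 by rewrite expf_neq0.
  rewrite -[in LHS](mulrI_eq0 _ (lregP p2)) E mulrI_eq0; last exact/lregP.
  by rewrite pnatr_eq0 cards_eq0.
split=> [/set0Pn[col]|[col colP]].
  by rewrite inE => /forallP colP; exists col => e; apply/eqP.
apply/set0Pn; exists (finfun col); rewrite inE; apply/forallP=> e; rewrite !ffunE.
exact/eqP/colP.
Qed.

(** * The evaluations at 3 and 4 *)

Section PlaneFlags.

Variable G : ribbon_graph.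

Lemma connected_flags (y : flag G -> bool) : connected G ->
  (forall p, y (corner p) = y p) -> (forall p, y (dele p) = y p) ->
  (forall p, y (face p) = y p) -> forall p q, y p = y q.
Proof.
move=> cG yk yd yf p q; pose g v := [exists p, (att p.1 == v) && y p].
have gE r : y r = g (att r.1).
  apply/idP/existsP => [yr|[r' /andP[/eqP rr' yr']]].
    by exists r; rewrite eqxx.
  by rewrite -(vertex_flag yk yd rr').
have inv : invariant_fun (adj setT) g.
  move=> u v /existsP[h /and3P[_ /eqP<- /eqP<-]].
  by rewrite -(gE (h, true)) -yf gE.
by rewrite !gE; apply: (connect_invariant inv); apply: n_comp1_connect (adj_sym _) cG.
Qed.

Lemma no_isolated (e : edge G) : connected G -> num_isolated G = 0%N.
Proof.
move=> cG; apply/eqP; rewrite /num_isolated cards_eq0; apply/eqP/setP=> v.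
rewrite !inE; apply/negbTE/negP=> /forallP isov.
have inv : invariant_fun (adj (setT : {set edge G})) (eq_op v).
  move=> u w /existsP[h /and3P[_ /eqP<- /eqP<-]].
  by rewrite ![v == _]eq_sym !(negPf (isov _)).
have := connect_invariant inv (n_comp1_connect v (att (e, true)) (adj_sym setT) cG).
by rewrite eqxx eq_sym (negPf (isov _)).
Qed.

Lemma card_flag : #|{: flag G}| = (4 * #|edge G|)%N.
Proof. by rewrite !card_prod card_bool -mulnA mulnC. Qed.

(** Here the vanishing of the first homology of the sphere enters: [a] is a function on vertices,
    [b] one on faces. *)
Lemma plane_split (x : flag G -> bool) : plane G -> (forall p, x (corner p) = x p) ->
  (forall p, x p (+) x (dele p) (+) x (face p) (+) x (cros p) = false) ->
  exists a b : flag G -> bool,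
  [/\ forall p, a (corner p) = a p, forall p, a (dele p) = a p,
      forall p, b (corner p) = b p, forall p, b (face p) = b p &
      forall p, x p = a p (+) b p].
Proof.
move=> pG xk x4; have cG : connected G by case: pG.
have [E0|[e _]] := set_0Vmem (setT : {set edge G}).
  have nof (p : flag G) : False by have := in_setT (edge_of p); rewrite E0 inE.
  by exists xpredT, xpredT; split=> p; case: (nof p).
apply: (flag_split (s := snd) (q := fun p : flag G => p.1.2)
  (@cornerK G) (@deleK G) (@faceK G) (@dele_face G)) => //.
- by case=> h [].
- by move=> y yk yd yf; apply: connected_flags.
(* The case [set0] shows that the orbits of [corner] and [dele] are as many as the vertices; the
   case [setT] is Euler's formula for [G]. *)
have := plane_num_bdry set0 pG; have := plane_num_bdry setT pG.
have c1 : num_comp [set: edge G] = 1%N := cG.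
rewrite !num_bdryE (no_isolated e cG) num_comp0 c1 cards0 cardsT card_flag.
have -> : num_loops (set0 : {set edge G}) = n_comp (dih (@corner G) (@dele G)) predT.
  by rewrite num_loopsE; apply: eq_n_comp_dih => p; rewrite end_arcE inE.
have -> : num_loops (setT : {set edge G}) = n_comp (dih (@corner G) (@face G)) predT.
  by rewrite num_loopsE; apply: eq_n_comp_dih => p; rewrite end_arcE inE.
move: (n_comp _ _) (n_comp _ _) => a b; clear; lia.
Qed.

Lemma sum_flags_corner (F : flag G -> bool) :
  (forall p, F (corner p) = F p) -> \big[addb/false]_p F p = false.
Proof.
move=> Fk; rewrite (bigID (fun p : flag G => p.2)) /=.
rewrite (reindex_inj (inv_inj (@cornerK G))) /=.
rewrite (eq_bigl (fun p : flag G => ~~ p.2)) => [|[h []]] //.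
by rewrite (eq_bigr F) ?addbb.
Qed.

Lemma sum_flags_edge (F : flag G -> bool) :
  \big[addb/false]_p F p = \big[addb/false]_e
    let p := ((e, true), true) in F p (+) F (dele p) (+) F (face p) (+) F (cros p).
Proof.
transitivity (\big[addb/false]_(h : edge G * bool) (F (h, true) (+) F (h, false))).
  rewrite (eq_bigr (fun p => F (p.1, p.2))) => [|[h b] _ //].
  rewrite -(pair_bigA _ (fun h b => F (h, b))) /=.
  by apply: eq_bigr => h _; rewrite big_bool.
rewrite (eq_bigr (fun h => F ((h.1, h.2), true) (+) F ((h.1, h.2), false))) => [|[e c] _ //].
rewrite -(pair_bigA _ (fun e c => F ((e, c), true) (+) F ((e, c), false))) /=.
apply: eq_bigr => e _; rewrite big_bool /= /cros /face /dele /opp_half /=.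
by rewrite -!addbA; case: (twisted e) => //=; do 2 congr addb; rewrite addbC.
Qed.

(* A cut and a cycle have an even number of common edges. *)
Lemma cut_cycle (a b : flag G -> bool) :
  (forall p, a (corner p) = a p) -> (forall p, a (dele p) = a p) ->
  (forall p, b (corner p) = b p) -> (forall p, b (face p) = b p) ->
  \big[addb/false]_e (let p := ((e, true), true) : flag G in
    (a p (+) a (face p)) && (b p (+) b (dele p))) = false.
Proof.
(* The values [a p && b p] cancel in pairs under [corner]; at each edge the four of them add up to
   the product of the two differences. *)
move=> ak ad bk bf; rewrite -[RHS](@sum_flags_corner (fun p => a p && b p)); last first.
  by move=> p; rewrite ak bk.
rewrite sum_flags_edge; apply: eq_bigr => e _ /=; set p := ((e, true), true).
rewrite ad /cros ad dele_face bf.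
by rewrite bf; case: (a p); case: (a (face p)); case: (b p); case: (b (dele p)).
Qed.

End PlaneFlags.

(** * Labellings of flags and their crossings *)

Section Valuations.

Variable G : ribbon_graph.

Definition flag0 (e : edge G) : flag G := ((e, true), true).

(** [dele_at] is not crossing at [e], [cros_at] is crossing. Each involution pairs the four flags,
    so two equations suffice. *)
Definition dele_at (S : eqType) (x : flag G -> S) e :=
  let p := flag0 e in (x (dele p) == x p) && (x (cros p) == x (face p)).

Definition cros_at (S : eqType) (x : flag G -> S) e :=
  let p := flag0 e in (x (cros p) == x p) && (x (face p) == x (dele p)).

Lemma flags_of_edge (P : flag G -> Prop) e :
  P (flag0 e) -> P (dele (flag0 e)) -> P (face (flag0 e)) -> P (cros (flag0 e)) ->
  forall p, edge_of p = e -> P p.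
Proof.
move=> P1 P2 P3 P4 p /eqP; rewrite -[X in _ == X]/(edge_of (flag0 e)) edge_ofP !inE.
by case/or4P=> /eqP->.
Qed.

Lemma dele_atP (S : eqType) (x : flag G -> S) e :
  reflect (forall p, edge_of p = e -> x (dele p) = x p) (dele_at x e).
Proof.
apply: (iffP andP) => [[/eqP x1 /eqP x2] | xd]; last first.
  by split; apply/eqP; apply: xd.
by apply: flags_of_edge; rewrite /cros ?deleK.
Qed.

Lemma cros_atP (S : eqType) (x : flag G -> S) e :
  reflect (forall p, edge_of p = e -> x (cros p) = x p) (cros_at x e).
Proof.
apply: (iffP andP) => [[/eqP x1 /eqP x2] | xd].
  by apply: flags_of_edge; rewrite ?cros_dele ?crosK //; rewrite /cros faceK.
by split; apply/eqP; [|rewrite -cros_dele]; apply: xd.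
Qed.

Lemma inv_funs_petrie (S : finType) (C : {set S}) (A : {set edge G})
    (x : {ffun flag G -> S}) :
  (x \in inv_funs C (@boundary_adj (petrie_dual G) A))
  = (x \in inv_funs C (frel (@corner G)))
    && [forall e, if e \in A then cros_at x e else dele_at x e].
Proof.
have bE : @boundary_adj (petrie_dual G) A =2
    dih (@corner G) (fun p : flag G => if edge_of p \in A then cros p else dele p).
  move=> p q; rewrite boundary_adjE /dih end_arcE.
  (* The extra half-twist turns [face] into [cros]. *)
  have -> // : @face (petrie_dual G) p = @cros G p.
  by rewrite /cros /face /dele /petrie_dual /=; case: (@twisted G _); rewrite ?negbK.
apply/inv_funsP/andP => [[xC xi] | [/inv_funsP[xC xk] /forallP xi]].
  have xk p : x (corner p) = x p by apply/esym/xi; rewrite bE /dih eqxx.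
  have xe p : x (if edge_of p \in A then cros p else dele p) = x p.
    by apply/esym/xi; rewrite bE /dih eqxx orbT.
  split; first by apply/inv_funsP; split=> // p _ /eqP<-.
  apply/forallP=> e; case: ifP => eA; [apply/cros_atP | apply/dele_atP] => p pe;
    have := xe p; rewrite pe eA; exact.
split=> // p q; rewrite bE => /orP[]/eqP->; first by apply: xk; rewrite /= eqxx.
have := xi (edge_of p); case: ifP => _; first by move/cros_atP->.
by move/dele_atP->.
Qed.

(** Replace each power by a count of labellings and exchange the sums; for a fixed labelling the sum
    over [A] factorises over the edges. *)
Lemma alternating_loops_nat (S : finType) (C : {set S}) :
  alternating_loops G #|C|%:R = #|C|%:R ^+ num_isolated G
    * \sum_(x in inv_funs C (frel (@corner G)))
        \prod_e (- (cros_at x e)%:R + (dele_at x e)%:R).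
Proof.
have termE (A : {set edge G}) : (#|C|%:R : rat) ^+ @num_bdry (petrie_dual G) A
  = #|C|%:R ^+ num_isolated G * \sum_(x in inv_funs C (frel (@corner G)))
      [forall e, if e \in A then cros_at x e else dele_at x e]%:R.
  rewrite (@num_bdryE (petrie_dual G) A) addnC exprD; congr (_ * _).
  rewrite /num_loops -natrX -(card_inv_funs C (@boundary_adj_sym (petrie_dual G) A)) -natr_sum.
  congr (_%:R); rewrite -sum1_card big_mkcond [RHS]big_mkcond /=.
  by apply: eq_bigr => x _; rewrite inv_funs_petrie; case: (x \in _).
rewrite /alternating_loops; under eq_bigr do rewrite termE mulrCA mulr_sumr.
rewrite -mulr_sumr; congr (_ * _); rewrite exchange_big /=; apply: eq_bigr => x _.
rewrite bigA_distr; apply: eq_bigr => A _.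
have -> : (-1) ^+ #|A| = \prod_(e : edge G) (if e \in A then -1 else 1) :> rat.
  by rewrite -big_mkcond /= prodr_const.
case: (boolP [forall e, if e \in A then cros_at x e else dele_at x e])
  => [/forallP xA | /forallPn[e xe]]; rewrite ?mulr1 ?mulr0.
  by apply: eq_bigr => e _; have := xA e; case: ifP => _ ->.
rewrite (bigD1 e) //=; move: xe; case: ifP => _ /negPf->; by rewrite ?oppr0 mul0r.
Qed.

(** This is the condition that no factor in [alternating_loops_nat] vanishes. *)
Definition admissible (S : eqType) (x : flag G -> S) :=
  [forall e, dele_at x e (+) cros_at x e].

Lemma admissible_sum (S : eqType) (x : flag G -> S) p (f : S -> bool) :
  admissible x ->
  f (x p) (+) f (x (dele p)) (+) f (x (face p)) (+) f (x (cros p)) = false.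
Proof.
move=> /forallP/(_ (edge_of p)).
case: (boolP (dele_at x _)) => [/dele_atP xd _ | _ /cros_atP xc].
  have -> : x (dele p) = x p by apply: xd.
  have -> : x (cros p) = x (face p) by apply: xd.
  by rewrite addbb addFb addbb.
have -> : x (cros p) = x p by apply: xc.
have -> : x (face p) = x (dele p) by rewrite -(cros_dele p); apply: xc.
by case: (f (x p)); case: (f (x (dele p))).
Qed.

(* In the plane the transition curves of two different colours cross an even
   number of times: writing [x] as a sum of a vertex and a face valuation, the
   crossings are counted by a pairing of cuts with cycles. *)
Lemma even_crossings (x : flag G -> bool * bool) : plane G ->
  (forall p, x (corner p) = x p) -> admissible x ->
  ~~ odd #|[set e | cros_at x e]|.
Proof.
move=> pG xk adm.
have x4 p f := admissible_sum p f adm.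
have [a1 [b1 [a1k a1d b1k b1f x1]]] := plane_split pG (fun p => congr1 fst (xk p)) (x4^~ fst).
have [a2 [b2 [a2k a2d b2k b2f x2]]] := plane_split pG (fun p => congr1 snd (xk p)) (x4^~ snd).
rewrite -sum1dep_card big_mkcond (big_morph odd oddD (erefl _)) /=.
have := cut_cycle a1k a1d b1k b1f; have := cut_cycle a2k a2d b2k b2f.
have := cut_cycle a1k a1d b2k b2f.
pose B a b (e : edge G) := let p := ((e, true), true) : flag G in
    (a p (+) a (face p)) && (b p (+) b (dele p)).
rewrite -/(B a1 b2 _) => c12 c22 c11.
(* Let [u] and [v] in [F_2^2] be the differences of [a] and of [b] at [e]. Not crossing means
   [v = 0], crossing means [u = v <> 0]. The form [u1 v1 + u2 v2 + u1 v2] is 0 in the first case and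
   1 in the second, as [t1^2 + t2^2 + t1 t2] has no nontrivial zero. *)
suff -> : \big[addb/false]_e odd (if cros_at x e then 1 else 0)
   = \big[addb/false]_e (B a1 b1 e (+) (B a2 b2 e (+) B a1 b2 e)).
  by rewrite !big_split /= c12 c22 c11.
apply: eq_bigr => e _; rewrite /B; set p := ((e, true), true) : flag G.
have xE q : x q = (a1 q (+) b1 q, a2 q (+) b2 q) by rewrite -x1 -x2; case: (x q).
have /forallP/(_ e) := adm; rewrite /dele_at /cros_at /flag0 -/p !xE /cros !xpair_eqE.
rewrite !a1d !a2d [dele (face p)]dele_face !b1f !b2f.
move: (a1 p) (a2 p) (b1 p) (b2 p) (a1 (face p)) (a2 (face p)) (b1 (dele p)) (b2 (dele p)).
by do 8 case.
Qed.

(** By [even_crossings] every admissible labelling contributes 1, and the others contribute 0. *)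
Lemma alternating_loops_gt0 (C : {set bool * bool}) : plane G -> C != set0 ->
  0 < alternating_loops G #|C|%:R <->
  exists x : flag G -> bool * bool,
    [/\ forall p, x p \in C, forall p, x (corner p) = x p & admissible x].
Proof.
move=> pG C0; rewrite alternating_loops_nat pmulr_rgt0; last first.
  by apply: exprn_gt0; rewrite ltr0n card_gt0.
rewrite (eq_bigr (fun x : {ffun _} => (admissible x)%:R)) => [|x /inv_funsP[_ xk]].
  rewrite -natr_sum ltr0n; split=> [|[x [xC xk adm]]].
    rewrite lt0n sum_nat_eq0 => /forall_inPn[x /inv_funsP[xC xk]] adm.
    exists x; split=> // [p|]; first by apply/esym/xk; rewrite /= eqxx.
    by move: adm; case: (admissible x).
  have fx : finfun x =1 x by move=> p; rewrite ffunE.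
  rewrite (bigD1 (finfun x)) /=.
    have -> // : admissible (finfun x); apply/forallP=> e; have /forallP/(_ e) := adm.
    by rewrite /dele_at /cros_at !fx.
  by apply/inv_funsP; split=> [p|p q /eqP<-]; rewrite !fx.
have {}xk p : x (corner p) = x p by apply/esym/xk; rewrite /= eqxx.
case: (boolP (admissible x)) => [adm | /forallPn[e ne]]; last first.
  rewrite (bigD1 e) //= (_ : _ + _ = 0) ?mul0r //.
  by move: ne; case: dele_at; case: cros_at => //= _; rewrite ?addNr ?oppr0 ?addr0.
have := even_crossings pG xk adm; have /forallP admE := adm.
rewrite (eq_bigr (fun e => if cros_at x e then -1 else 1)) => [|e _].
  rewrite -big_mkcond /= prodr_const => ev.
  by rewrite cardsE in ev; rewrite -signr_odd (negPf ev).
by have := admE e; case: dele_at; case: cros_at => //= _; rewrite ?oppr0 ?add0r ?addr0.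
Qed.

End Valuations.

Lemma bool2_ord4 : exists f : bool * bool -> 'I_4, bijective f.
Proof.
have c4 : #|{: bool * bool}| = 4 by rewrite card_prod card_bool.
exists (fun m => cast_ord c4 (enum_rank m)).
exists (fun i => enum_val (cast_ord (esym c4) i)) => m.
  by rewrite cast_ordK enum_rankK.
by rewrite enum_valK cast_ordKV.
Qed.

(** * From labellings to 4-colourings and back *)

Section Colourings.

Variable G : ribbon_graph.

Lemma vertex_valuation (S : eqType) (s0 : S) (a : flag G -> S) :
  (forall p, a (corner p) = a p) -> (forall p, a (dele p) = a p) ->
  exists col : vertex G -> S, forall p, a p = col (att p.1).
Proof.
move=> ak ad.
(* [s0] is the colour of the isolated vertices. *)
exists (fun v => if [pick p : flag G | att p.1 == v] is Some p then a p else s0) => p.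
case: pickP => [q /eqP qp|/(_ p)]; last by rewrite eqxx.
exact: vertex_flag ak ad (esym qp).
Qed.

(** If the two labels agreed, either kind of transition would make all four labels at the edge
    equal, and then both kinds would hold. *)
Lemma admissible_face (S : eqType) (x : flag G -> S) p :
  admissible x -> x (face p) != x p.
Proof.
move=> /forallP/(_ (edge_of p)); apply: contraL => /eqP fp.
have e4 q : edge_of q = edge_of p -> dele_at x (edge_of p) || cros_at x (edge_of p) ->
    x q = x p.
  move=> /eqP; rewrite edge_ofP !inE => qp /orP[/dele_atP xd|/cros_atP xc].
    case/or4P: qp => /eqP-> //; first exact: xd.
    by rewrite -fp; apply: xd.
  have xdp : x (dele p) = x p by rewrite -fp -(cros_dele p); apply/esym/xc.
  by case/or4P: qp => /eqP-> //; apply: xc.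
case: (boolP (dele_at x (edge_of p) || cros_at x (edge_of p)))
  => [dc|]; last by case: dele_at; case: cros_at.
have -> : dele_at x (edge_of p) by apply/dele_atP=> q qe; rewrite !e4.
by have -> : cros_at x (edge_of p) by apply/cros_atP=> q qe; rewrite !e4.
Qed.

(** The vertex part of [x] is the colouring: the face part agrees at [p] and [face p], so there the
    vertex part must differ. *)
Lemma admissible_4colouring (x : flag G -> bool * bool) : plane G ->
  (forall p, x (corner p) = x p) -> admissible x ->
  exists col : vertex G -> 'I_4, proper_colouring col.
Proof.
move=> pG xk adm.
have x4 p f := admissible_sum p f adm.
have [a1 [b1 [a1k a1d b1k b1f x1]]] := plane_split pG (fun p => congr1 fst (xk p)) (x4^~ fst).
have [a2 [b2 [a2k a2d b2k b2f x2]]] := plane_split pG (fun p => congr1 snd (xk p)) (x4^~ snd).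
have [||col colE] := @vertex_valuation _ (false, false) (fun p => (a1 p, a2 p)).
- by move=> p; rewrite a1k a2k.
- by move=> p; rewrite a1d a2d.
have [f /bij_inj f_inj] := bool2_ord4.
exists (f \o col) => e /= /f_inj; pose p := ((e, false), true) : flag G.
rewrite -(colE p) -(colE (face p)) => -[a1e a2e].
have /eqP := admissible_face p adm; case: (x (face p)) (x1 (face p)) (x2 (face p)).
by case: (x p) (x1 p) (x2 p) => ? ? /= -> -> ? ? /= -> ->; rewrite b1f b2f a1e a2e.
Qed.

(** At an edge the two values of [b] avoid the two distinct values of [a]. Either they are equal, or
    all four elements of [F_2^2] occur; these add up to 0, so the differences of [a] and [b] agree
    and the edge is crossing. *)
Lemma split_admissible (a b : flag G -> bool * bool) :
  (forall p, a (dele p) = a p) -> (forall p, b (face p) = b p) ->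
  (forall p, a (face p) != a p) ->
  (forall p, a p != b p) ->
  admissible (fun p => ((a p).1 (+) (b p).1, (a p).2 (+) (b p).2)).
Proof.
move=> ad bf af ab; apply/forallP=> e; rewrite /dele_at /cros_at.
set p := flag0 e; have := ab p; have := ab (face p); have := ab (dele p).
have := ab (cros p); have := af p; rewrite /cros !ad dele_face !bf.
move: (a p) (a (face p)) (b p) (b (dele p)).
by case=> [[] []] [[] []] [[] []] [[] []].
Qed.

Lemma colouring_admissible (col : vertex G -> 'I_4) : proper_colouring col ->
  exists x : flag G -> bool * bool, (forall p, x (corner p) = x p) /\ admissible x.
Proof.
move=> colP; have [f [g fK gK]] := bool2_ord4.
exists (fun p => g (col (att p.1))); split=> [p|]; first by rewrite att_corner.
apply/forallP=> e; rewrite /dele_at /cros_at /= !eqxx /=.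
by rewrite (inj_eq (can_inj gK)) eq_sym; case: eqP => // /esym/colP.
Qed.

End Colourings.

(** * Putting a vertex in every face *)

(** [w] orients the faces and the second component of a flag orients the vertex discs. Their
    difference is a vertex part plus a face part, by which the two are corrected to agree. *)
Lemma plane_orientation (G : ribbon_graph) : plane G ->
  exists o : flag G -> bool, forall p,
    [/\ o (corner p) = ~~ o p, o (dele p) = ~~ o p & o (face p) = ~~ o p].
Proof.
move=> pG; have [w wP] := dih_bipartite (@cornerK G) (@faceK G) (@corner_neq G) (@face_neq G).
have wk p : w (corner p) = ~~ w p by case: (wP p).
have wf p : w (face p) = ~~ w p by case: (wP p).
have [p|p|a [b [ak ad bk bf wE]]] := @plane_split G (fun p => w p (+) p.2) pG.
- by rewrite wk; case: p => h []; case: (w _).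
- have -> : w (cros p) = ~~ w (dele p) by rewrite /cros dele_face wf.
  rewrite wf -[(cros p).2]/(~~ (face p).2) -[(dele p).2]/(~~ p.2).
  by case: (w p); case: (w (dele p)); case: p.2; case: (face p).2.
exists (fun p => w p (+) b p) => p; split; first by rewrite wk bk addNb.
  have oE q : w q (+) b q = q.2 (+) a q.
    by have := wE q; case: (w q); case: (b q); case: (a q); case: q.2.
  by rewrite !oE ad /= addNb.
by rewrite wf bf addNb.
Qed.

(** * Untwisted ribbon graphs from a rotation *)

Section RotationGraph.

Variables (E : finType) (r : {perm E * bool}).

Definition orbit_vertex := {S : {set E * bool} | S \in porbits r}.

Lemma porbit_in_porbits h : porbit r h \in porbits r.
Proof. exact: imset_f. Qed.

Definition orbit_att h : orbit_vertex := exist _ (porbit r h) (porbit_in_porbits h).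

Lemma orbit_att_rot h k : (orbit_att h == orbit_att k) = (k \in porbit r h).
Proof. by rewrite -val_eqE /= eq_porbit_mem porbit_sym. Qed.

Definition rotation_graph := RibbonGraph (fun=> false) orbit_att_rot.

Lemma orbit_att_surj (v : vertex rotation_graph) : exists h, v = orbit_att h.
Proof.
case: v => S SP; have /imsetP[h _ Sh] := SP.
by exists h; apply: val_inj.
Qed.

Lemma orbit_att_invariant (S : Type) (c : E * bool -> S) h k :
  (forall h, c (r h) = c h) -> orbit_att h = orbit_att k -> c h = c k.
Proof.
move=> cr /eqP; rewrite orbit_att_rot => /porbitP[n ->].
by elim: n => [|n ->]; rewrite ?expg0 ?perm1 // expgSr permM cr.
Qed.

Lemma card_orbit_vertex (S : finType) (c : E * bool -> S) :
  (forall h, c (r h) = c h) -> (#|codom c| <= #|vertex rotation_graph|)%N.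
Proof.
move=> cr; rewrite card_sig.
pose g (X : {set E * bool}) := omap c [pick h in X].
have Some_injS : injective (@Some S) by move=> x y [].
rewrite -(card_image Some_injS).
apply: (@leq_trans #|[set g X | X in porbits r]|); last first.
  by apply: leq_trans (leq_imset_card _ _) _; rewrite cardE.
apply/subset_leq_card/subsetP=> _ /imageP[_ /codomP[h ->] ->].
apply/imsetP; exists (porbit r h); first exact: imset_f.
rewrite /g; case: pickP => [k /porbitP[n ->]|/(_ h)]; last by rewrite porbit_id.
congr Some; elim: n => [|n IHn]; first by rewrite expg0 perm1.
by rewrite expgSr permM cr.
Qed.

End RotationGraph.

Lemma opp_halfK (T : Type) : involutive (@opp_half T).
Proof. by case=> x b; rewrite /opp_half /= negbK. Qed.

(** * The face stellation of an oriented graph *)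

Section FaceStellation.

Variables (G : ribbon_graph) (o : flag G -> bool).
Hypothesis ok : forall p, o (corner p) = ~~ o p.
Hypothesis od : forall p, o (dele p) = ~~ o p.
Hypothesis of_ : forall p, o (face p) = ~~ o p.

Local Notation half := (edge G * bool)%type.

(* The flag of [h] that is positive for the global orientation [o]. *)
Definition pos_flag (h : half) : flag G := (h, o (h, true)).

Lemma pos_flagP h : o (pos_flag h).
Proof.
rewrite /pos_flag; case oh: (o (h, true)) => //.
by rewrite -[(h, false)]/(dele (h, true)) od oh.
Qed.

Lemma pos_flagE p : p = if o p then pos_flag p.1 else dele (pos_flag p.1).
Proof.
have E q r : o q = o r -> q.1 = r.1 -> q = r.
  case: q r => [h s] [k t] /= qr hk; move: qr; rewrite -{}hk => {k}.
  case: s t => [] [] //; rewrite -[(h, false)]/(dele (h, true)) od.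
    by case: (o _).
  by case: (o _).
by case: ifP => op; apply: E; rewrite //= ?op ?od pos_flagP.
Qed.

Definition next_half (h : half) : half := (corner (pos_flag h)).1.

Lemma corner_pos h : corner (pos_flag h) = dele (pos_flag (next_half h)).
Proof. by rewrite [LHS]pos_flagE ok pos_flagP. Qed.

Lemma face_pos h : face (pos_flag h) = dele (pos_flag (opp_half h)).
Proof. by rewrite [LHS]pos_flagE of_ pos_flagP. Qed.

Lemma next_half_inj : injective next_half.
Proof.
move=> h k hk; have : corner (pos_flag h) = corner (pos_flag k) by rewrite !corner_pos hk.
by move/(inv_inj (@cornerK G))/(congr1 fst).
Qed.

Definition next_perm := perm next_half_inj.

(** The corners after [h] and before [opp_half h] are consecutive along a face. *)
Definition prev_corner (h : half) : half := (next_perm^-1)%g (opp_half h).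

Lemma next_prev_corner h : next_half (prev_corner h) = opp_half h.
Proof. by rewrite -[LHS](permE next_half_inj) /prev_corner permKV. Qed.

Definition st_edge : finType := (edge G + edge G * bool)%type.
Local Notation st_half := (st_edge * bool)%type.

(* Besides the edges of [G] there is one edge [inr h] for every corner, the
   corner being named by the half-edge [h] that it follows; its end
   [(inr h, false)] is at a vertex of [G], its end [(inr h, true)] at a face. *)
Definition st_next (x : st_half) : st_half :=
  match x with
  | (inl e, c) => (inr (e, c), false)
  | (inr h, false) => let k := next_half h in (inl k.1, k.2)
  | (inr h, true) => (inr (prev_corner h), true)
  end.

Lemma st_next_inj : injective st_next.
Proof.
move=> [[e|h] c] [[e'|h'] c'] /=.
- by case=> -> ->.
- by case: c'.
- by case: c.
case: c; case: c' => //= -[].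
  by move/perm_inj/(inv_inj (@opp_halfK _))->.
by move=> e1 e2; congr (inr _, _); apply/next_half_inj/injective_projections.
Qed.

Definition st_perm := perm st_next_inj.
Definition stellation := rotation_graph st_perm.

Lemma st_loop (S : Type) (c : st_half -> S) (cP : forall x, c (st_next x) = c x) x :
  c (st_perm x) = c x.
Proof. by rewrite permE. Qed.

(** The vertex or face of [G] at which a half-edge sits, a face being represented by the root of its
    flags. *)
Definition st_base (x : st_half) : vertex G + flag G :=
  match x with
  | (inl e, c) => inl (att (e, c))
  | (inr h, false) => inl (att h)
  | (inr h, true) => inr (fingraph.root (dih (@corner G) (@face G)) (pos_flag h))
  end.

Lemma att_next h : att (next_half h) = att h.
Proof. by rewrite /next_half att_corner. Qed.

Lemma face_connect_prev h :
  connect (dih (@corner G) (@face G)) (pos_flag h) (pos_flag (prev_corner h)).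
Proof.
apply: (@connect_trans _ _ (face (pos_flag h))); apply: connect1.
  by rewrite /dih eqxx orbT.
rewrite /dih -(inj_eq (inv_inj (@cornerK G))) cornerK corner_pos next_prev_corner.
by rewrite face_pos eqxx.
Qed.

Lemma st_base_next x : st_base (st_next x) = st_base x.
Proof.
have sc := sym_connect_sym (dih_sym (@cornerK G) (@faceK G)).
case: x => [[e|h] []] //=; last by rewrite -surjective_pairing att_next.
by congr inr; apply/(fingraph.rootP sc); rewrite sc face_connect_prev.
Qed.

(** The faces of the stellation are triangles, one on each side of each edge of [G]; half-edges of
    [G] name these sides. *)
Definition st_label (p : flag stellation) : half :=
  match p with
  | (inl e, c, true) => (e, c)
  | (inl e, c, false) => opp_half (e, c)
  | (inr h, c, s) => if c == s then h else opp_half (next_half h)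
  end.

Lemma st_label_face p : st_label (face p) = st_label p.
Proof. by case: p => [[[e|h] c] s]; rewrite /face /=; case: c s => [] []. Qed.

Lemma st_label_corner p : st_label (corner p) = st_label p.
Proof.
suff E x : st_label (corner (x, true)) = st_label (x, true).
  by case: p => x [] //; rewrite -[RHS](congr1 st_label (cornerK _)) E.
rewrite /corner /= permE; case: x => [[e|h] []] //=.
by rewrite next_prev_corner opp_halfK.
Qed.

Lemma stellation_loopless : loopless G -> loopless stellation.
Proof.
move=> lG x; apply/eqP=> /(orbit_att_invariant (st_loop st_base_next)).
case: x => [e|h] //= -[] /eqP; by rewrite (negPf (lG e)).
Qed.

Lemma stellation_invariant (S : eqType) (c : st_half -> S) :
  (forall x, c (st_next x) = c x) ->
  forall p : flag G, c (inl (corner p).1.1, (corner p).1.2) = c (inl p.1.1, p.1.2).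
Proof.
move=> cP p.
have E h : c (inl (next_half h).1, (next_half h).2) = c (inl h.1, h.2).
  by rewrite -[RHS]cP -[RHS]cP /=; case: h.
have kn q : o q -> (corner q).1 = next_half q.1.
  by move=> oq; rewrite /next_half; congr (corner _).1; rewrite [LHS]pos_flagE oq.
case op: (o p); first by rewrite kn // E.
have okp : o (corner p) by rewrite ok op.
by rewrite -[in RHS](cornerK p) (kn _ okp) E.
Qed.

Lemma stellation_connected (e : edge G) : connected G -> connected stellation.
Proof.
move=> cG; apply: (@n_comp_eq1 _ (@adj stellation setT)
  (orbit_att st_perm (inl e, true)) (@adj_sym _ _)) => g gi v.
have [x ->] := orbit_att_surj v.
pose c (x : st_half) := g (orbit_att st_perm x).
have cn y : c (st_next y) = c y.
  rewrite /c; congr g; apply/eqP; rewrite eq_sym orbit_att_rot.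
  by rewrite -[st_next y](permE st_next_inj); apply: (mem_porbit _ 1).
have co y : c (opp_half y) = c y.
  apply/esym/gi; apply/existsP; by exists y; rewrite inE !eqxx.
have cE (p q : flag G) : c (inl p.1.1, p.1.2) = c (inl q.1.1, q.1.2).
  pose y (p : flag G) := c (inl p.1.1, p.1.2).
  apply: (@connected_flags G y) => // r; first exact: stellation_invariant.
  exact: (co (inl r.1.1, r.1.2)).
rewrite -/(c _) -[RHS]/(c _); case: x => [[e'|h] b].
  exact: (cE ((e', b), true) ((e, true), true)).
have -> : c (inr h, b) = c (inr h, false) by case: b => //; rewrite -co.
have <- : c (inl h.1, h.2) = c (inr h, false) by rewrite -cn /=; case: h.
exact: (cE (h, true) ((e, true), true)).
Qed.

(** There are [3|E|] edges, at least [v + f] vertices by [st_base] and at least [2|E|] faces by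
    [st_label], so the genus is at most that of [G]; it is also nonnegative. *)
Lemma stellation_plane (e : edge G) : plane G -> plane stellation.
Proof.
move=> pG; have cG : connected G by case: pG.
have cS := stellation_connected e cG; split=> //.
have c1 : num_comp [set: edge G] = 1%N := cG.
have cS1 : num_comp [set: edge stellation] = 1%N := cS.
have bS : (#|{: half}| <= num_bdry [set: edge stellation])%N.
  rewrite num_bdryE num_loopsE; apply: leq_trans (leq_addr _ _).
  apply: leq_trans (n_comp_card_ge (g := st_label) _ _).
  - apply/subset_leq_card/subsetP=> -[e' c] _.
    by apply/codomP; exists ((inl e', c), true).
  - exact: dih_sym (@cornerK _) (end_arcK _).
  apply/dih_invariantP; split=> p; first exact: st_label_corner.
  by rewrite end_arcE inE st_label_face.
have vS : (#|vertex G| + num_loops [set: edge G] <= #|vertex stellation|)%N.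
  apply: leq_trans (card_orbit_vertex (st_loop st_base_next)).
  rewrite num_loopsE.
  have -> : n_comp (dih (@corner G) (end_arc setT)) predT = n_comp (dih (@corner G) (@face G)) predT.
    by apply: eq_n_comp_dih => p; rewrite end_arcE inE.
  pose R := [set p : flag G | p \in roots (dih (@corner G) (@face G))].
  have -> : n_comp (dih (@corner G) (@face G)) predT = #|R|.
    by apply: eq_card => p; rewrite !inE andbT.
  have inl_i : injective (@inl (vertex G) (flag G)) by move=> ? ? [].
  have inr_i : injective (@inr (vertex G) (flag G)) by move=> ? ? [].
  rewrite -cardsT -(card_imset _ inl_i) -(card_imset _ inr_i) -cardsUI.
  rewrite (_ : _ :&: _ = set0) ?cards0 ?addn0; last first.
    apply/setP=> z; rewrite !inE; apply/negP=> /andP[/imsetP[u _ ->]].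
    by case/imsetP.
  apply/subset_leq_card/subsetP=> z; rewrite inE => /orP[]/imsetP[].
    move=> v _ ->; have := no_isolated e cG; rewrite /num_isolated => /eqP.
    rewrite cards_eq0 => /eqP/setP/(_ v); rewrite !inE.
    move/negbT/forallPn=> [h]; rewrite negbK => /eqP<-.
    by apply/codomP; exists (inl h.1, h.2) => /=; case: (h).
  move=> p; rewrite inE => rp ->.
  have sc := sym_connect_sym (dih_sym (@cornerK G) (@faceK G)).
  (* The root of a face may be negative for [o]; then its [corner], on the same face, is
     positive. *)
  pose q := if o p then p else corner p.
  have oq : o q by rewrite /q; case: ifP => // op; rewrite ok op.
  apply/codomP; exists (inr q.1, true) => /=; congr inr.
  have -> : pos_flag q.1 = q by rewrite [RHS]pos_flagE oq.
  rewrite -(eqP rp); apply/(fingraph.rootP sc); rewrite /q.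
  by case: ifP => _; rewrite ?connect0 //; apply: connect1; rewrite /dih eqxx.
have := plane_num_bdry setT pG; have := euler_genus_ge0 stellation.
rewrite num_bdryE (no_isolated e cG) c1 cardsT.
rewrite /euler_genus cS1; move: bS vS.
have -> : #|{: half}| = (#|edge G| * 2)%N by rewrite card_prod card_bool.
have -> : #|edge stellation| = (#|edge G| + #|edge G| * 2)%N.
  by rewrite /= card_sum card_prod card_bool.
move: (num_loops _) (num_bdry _) #|vertex G| #|vertex _| #|edge G| => f b v v' m.
by rewrite mulr2n; lia.
Qed.

Lemma stellation_valuation (col : vertex stellation -> bool * bool) :
  proper_colouring col ->
  exists a b : flag G -> bool * bool,
  [/\ forall p, a (corner p) = a p, forall p, a (dele p) = a p,
      forall p, b (corner p) = b p, forall p, b (face p) = b p &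
      (forall p, a (face p) != a p) /\ (forall p, a p != b p)].
Proof.
move=> colP; pose c (x : st_half) := col (orbit_att st_perm x).
have cn y : c (st_next y) = c y.
  rewrite /c; congr col; apply/eqP; rewrite eq_sym orbit_att_rot.
  by rewrite -[st_next y](permE st_next_inj); apply: (mem_porbit _ 1).
have co y : c (opp_half y) != c y.
  by apply/eqP; case: y => x [] => [|/esym]; apply: colP.
pose a (p : flag G) := c (inl p.1.1, p.1.2).
(* A corner is named by the half-edge of its positive flag. *)
pose b (p : flag G) := c (inr (if o p then p.1 else (corner p).1), true).
have ak p : a (corner p) = a p by apply: stellation_invariant.
have bk p : b (corner p) = b p by rewrite /b ok cornerK; case: (o p).
have bf p : b (face p) = b p.
  suff E q : o q -> b (face q) = b q.
    case op: (o p); first exact: E.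
    by rewrite -(E (face p)) ?faceK // of_ op.
  move=> oq; rewrite /b of_ oq /= -[RHS]cn /=; congr (c (inr _, true)).
  apply: next_half_inj; rewrite next_prev_corner.
  have okf : o (corner (face q)) by rewrite ok of_ oq.
  rewrite /next_half.
  have -> : pos_flag (corner (face q)).1 = corner (face q) by rewrite [RHS]pos_flagE okf.
  by rewrite cornerK.
exists a, b; split=> //; split=> p; first exact: (co (inl p.1.1, p.1.2)).
suff E q : o q -> a q != b q.
  case op: (o p); first exact: E.
  by rewrite -ak -bk E // ok op.
move=> oq; rewrite /b oq eq_sym; have <- : c (inr q.1, false) = a q.
  by rewrite /a -[RHS]cn /=; case: (q.1).
exact: (co (inr q.1, false)).
Qed.

End FaceStellation.

(** * The signs at 4 and 3, and the equivalences *)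

Lemma alternating_loops4_gt0 (G : ribbon_graph) : plane G ->
  0 < alternating_loops G 4 <-> exists col : vertex G -> 'I_4, proper_colouring col.
Proof.
move=> pG; have C0 : [set: bool * bool] != set0.
  by apply/set0Pn; exists (true, true); rewrite inE.
have := alternating_loops_gt0 pG C0; rewrite cardsT card_prod card_bool => ->.
split=> [[x [_ xk adm]]|[col /colouring_admissible[x [xk adm]]]].
  exact: admissible_4colouring adm.
by exists x; split=> // p; rewrite inE.
Qed.

Lemma alternating_loops3_gt0 (G : ribbon_graph) : plane G ->
  0 < alternating_loops G 3 <->
  exists x : flag G -> bool * bool,
    [/\ forall p, x p != (false, false), forall p, x (corner p) = x p & admissible x].
Proof.
move=> pG; have C0 : [set~ (false, false)] != set0.
  by apply/set0Pn; exists (true, true); rewrite !inE.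
have := alternating_loops_gt0 pG C0; rewrite cardsC1 card_prod card_bool => ->.
by split=> [[x [xC xk adm]]|[x [xC xk adm]]]; exists x; split=> // p;
  have := xC p; rewrite !inE.
Qed.

Lemma alternating_loops3_4 (G : ribbon_graph) : plane G ->
  0 < alternating_loops G 3 -> 0 < alternating_loops G 4.
Proof.
move=> pG /(alternating_loops3_gt0 pG)[x [_ xk adm]].
by apply/(alternating_loops4_gt0 pG)/(admissible_4colouring pG xk adm).
Qed.

(** In a 4-colouring of the stellation, the sum of the vertex and the face colour at each corner is
    nonzero, and these sums form an admissible labelling. *)
Lemma four_colour_alternating_loops3_gt0 (G : ribbon_graph) :
  four_colour_theorem -> plane G -> loopless G -> 0 < alternating_loops G 3.
Proof.
move=> FC pG lG; apply/(alternating_loops3_gt0 pG).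
have [E0|[e _]] := set_0Vmem (setT : {set edge G}).
  have noe (e : edge G) : False by have := in_setT e; rewrite E0 inE.
  by exists (fun=> (true, true)); split=> //; apply/forallP=> e; case: (noe e).
have [o oP] := plane_orientation pG.
have ok p : o (corner p) = ~~ o p by case: (oP p).
have od p : o (dele p) = ~~ o p by case: (oP p).
have of_ p : o (face p) = ~~ o p by case: (oP p).
have [col colP] := FC _ (@stellation_plane _ _ ok od of_ e pG)
  (@stellation_loopless _ _ ok od of_ lG).
have [f /bij_inj f_inj] : exists f : 'I_4 -> bool * bool, bijective f.
  by have [f [g fK gK]] := bool2_ord4; exists g; exists f.
have col'P : proper_colouring (f \o col) by move=> x /f_inj/colP.
have [a [b [ak ad bk bf [af ab]]]] := stellation_valuation of_ col'P.
exists (fun p => ((a p).1 (+) (b p).1, (a p).2 (+) (b p).2)); split=> [p|p|].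
- by have := ab p; case: (a p) (b p) => [[] []] [[] []].
- by rewrite ak bk.
exact: split_admissible.
Qed.

Theorem theorem5p4 :
  [<-> four_colour_theorem;
       forall G : ribbon_graph, connected G -> loopless G -> plane G ->
         (-1) ^+ #|vertex G|
         * ribbon_poly (petrie_dual G) (-2 : rat) (-3) (1 / 3) < 0;
       forall G : ribbon_graph, connected G -> loopless G -> plane G ->
         (-1) ^+ #|vertex G|
         * ribbon_poly (petrie_dual G) (-3 : rat) (-4) (1 / 4) < 0;
       forall G : ribbon_graph, connected G -> loopless G -> plane G ->
         ribbon_poly (petrie_dual G) (3 : rat) 2 (- (1 / 2)) != 0].
Proof.
(* Here [y = -3]; the negative factor [y^-1] reverses the inequality. The same happens for
   [y = -4]. *)
have e3 (G : ribbon_graph) : connected G ->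
    ((-1) ^+ #|vertex G| * ribbon_poly (petrie_dual G) (-2 : rat) (-3) (1 / 3) < 0)
    = (0 < alternating_loops G 3).
  move=> cG; have -> : -2 = -3 + 1 :> rat by ring.
  have -> : 1 / 3 = - (-3)^-1 :> rat by field.
  have N3 : (-3 : rat) != 0 by rewrite oppr_eq0 pnatr_eq0.
  have I3 : (-3 : rat)^-1 < 0 by rewrite invr_lt0 oppr_lt0 ltr0n.
  by rewrite (ribbon_poly_petrie cG N3) opprK (nmulr_rlt0 _ I3).
have e4 (G : ribbon_graph) : connected G ->
    ((-1) ^+ #|vertex G| * ribbon_poly (petrie_dual G) (-3 : rat) (-4) (1 / 4) < 0)
    = (0 < alternating_loops G 4).
  move=> cG; have -> : -3 = -4 + 1 :> rat by ring.
  have -> : 1 / 4 = - (-4)^-1 :> rat by field.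
  have N4 : (-4 : rat) != 0 by rewrite oppr_eq0 pnatr_eq0.
  have I4 : (-4 : rat)^-1 < 0 by rewrite invr_lt0 oppr_lt0 ltr0n.
  by rewrite (ribbon_poly_petrie cG N4) opprK (nmulr_rlt0 _ I4).
(* Here [y = 2] gives [l = -2]; the sign and the factor [y^-1] do not affect vanishing. *)
have e2 (G : ribbon_graph) : connected G ->
    (ribbon_poly (petrie_dual G) (3 : rat) 2 (- (1 / 2)) != 0)
    = (alternating_loops G (-2) != 0).
  move=> cG; have -> : 3 = 2 + 1 :> rat by ring.
  have N2 : (2 : rat) != 0 by rewrite pnatr_eq0.
  have Ns : (-1) ^+ #|vertex G| != 0 :> rat by rewrite signr_eq0.
  have I2 : (2 : rat)^-1 != 0 by rewrite invr_eq0.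
  rewrite mul1r -(mulrI_eq0 (ribbon_poly _ _ _ _) (lregP Ns)).
  by rewrite (ribbon_poly_petrie cG N2) (mulrI_eq0 _ (lregP I2)).
tfae.
- by move=> FC G cG lG pG; rewrite e3 //; apply: four_colour_alternating_loops3_gt0.
- by move=> H G cG lG pG; rewrite e4 //; apply/alternating_loops3_4; rewrite -?e3 ?H.
- move=> H G cG lG pG; rewrite e2 //; apply/(alternating_loops_m2_neq0 pG).
  by apply/(alternating_loops4_gt0 pG); rewrite -e4 ?H.
move=> H G pG lG; have cG : connected G by case: pG.
by apply/(alternating_loops_m2_neq0 pG); rewrite -e2 ?H.
Qed.
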